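(* Let $\mathbf X=(X,\mathbb X)$, $\tilde{\mathbf X}=(\tilde X,\tilde{\mathbb X})$ be $r$-rough paths on $[0,T]$, for some $r\in[2,3)$, and let $\mathbf Y=(Y,Y')$, $\tilde{\mathbf Y}=(\tilde Y,\tilde Y')$ be controlled rough paths (controlled by $\mathbf X$ and $\tilde{\mathbf X}$ respectively). Assume that $0<\frac1\alpha<r\le p\le\infty$ and $0<q\le\infty$. Then: \begin{align*} \|V^{r/2}\mathbb X\|_{B^{2\alpha}_{p/2,q/2}}&\lesssim \|\mathbb X\|_{B^{2\alpha}_{p/2,q/2}}+\|X\|_{B^\alpha_{p,q}}^2,\\ \|V^{r/2}R^{\mathbf Y,\mathbf X}\|_{B^{2\alpha}_{p/2,q/2}}&\lesssim \|R^{\mathbf Y,\mathbf X}\|_{B^{2\alpha}_{p/2,q/2}}+\|Y'\|_{B^\alpha_{p,q}}\|X\|_{B^\alpha_{p,q}},\\ \|V^{r/2}\Delta\mathbb X\|_{B^{2\alpha}_{p/2,q/2}}&\lesssim \|\Delta\mathbb X\|_{B^{2\alpha}_{p/2,q/2}}+\|\Delta X\|_{B^\alpha_{p,q}}\big(\|X\|_{B^\alpha_{p,q}}+\|\tilde X\|_{B^\alpha_{p,q}}\big),\\ \|V^{r/2}\Delta R^{\mathbf Y,\mathbf X}\|_{B^{2\alpha}_{p/2,q/2}}&\lesssim \|\Delta R^{\mathbf Y,\mathbf X}\|_{B^{2\alpha}_{p/2,q/2}}+\|\Delta Y'\|_{B^\alpha_{p,q}}\|X\|_{B^\alpha_{p,q}}+\|\tilde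 Y'\|_{B^\alpha_{p,q}}\|\Delta X\|_{B^\alpha_{p,q}}. \end{align*}
   Context: $\lesssim$ denotes inequality up to a multiplicative constant that does not depend on the rough paths and controlled rough paths. Let $T>0$ and $\Delta_T=\{(s,t)\in[0,T]^2: s\le t\}$. For $\chi:\Delta_T\to[0,\infty)$, $\alpha>0$, $p,q\in(0,\infty]$ put $$\Omega^\chi_p(t)=\sup_{0<h\le t}\Big(\int_0^{T-h}\chi(s,s+h)^p\,ds\Big)^{1/p},\qquad \|\chi\|_{B^\alpha_{p,q}}=\Big(\int_0^T\Big(\frac{\Omega_p^\chi(t)}{t^\alpha}\Big)^q\frac{dt}{t}\Big)^{1/q},$$ with the usual modifications if $p=\infty$ or $q=\infty$. For $\rho>0$ and an interval $I\subset[0,T]$, $V^\rho\chi_I=\sup_\pi(\sum_{i}\chi(\pi_i,\pi_{i+1})^\rho)^{1/\rho}$, supremum over finite increasing sequences in $I$; $V^\rho\chi$ also denotes the two-parameter function $(s,t)\mapsto V^\rho\chi_{[s,t]}$, so that $\|V^\rho\chi\|_{B^\alpha_{p,q}}$ makes sense. For a two-parameter map $A$ on $\Delta_T$ into a normed space these notions are applied to $\chi(s,t)=|A_{s,t}|$; for a path $f$ on $[0,T]$ to $\chi(s,t)=|f_{s,t}|$, where $f_{s,t}=f(t)-f(s)$. ''$A\in V^\rho$'' means $V^\rho A_{[0,T]}<\infty$. $E,F$ are normed spaces and $E\otimes E$ carries a norm with $|x\otimes y|=|x||y|$. An $r$-rough path ($r\in[2,3)$) is a map $(s,t)\mapsto(X_{s,t},\mathbb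 X_{s,t})\in E\oplus E^{\otimes2}$ with $X\in V^r$, $\mathbb X\in V^{r/2}$ and, for all $s\le u\le t$, $X_{s,t}=X_{s,u}+X_{u,t}$ and $\mathbb X_{s,t}=\mathbb X_{s,u}+\mathbb X_{u,t}+X_{s,u}\otimes X_{u,t}$. An $\mathbf X$-controlled $r$-rough path consists of $Y:[0,T]\to F$ and $Y':[0,T]\to L(E,F)$ with $Y'\in V^r$ and $R^{\mathbf Y,\mathbf X}_{s,t}:=Y_{s,t}-Y'_sX_{s,t}\in V^{r/2}$. Differences: $\Delta X=X-\tilde X$, $\Delta\mathbb X=\mathbb X-\tilde{\mathbb X}$, $\Delta Y'=Y'-\tilde Y'$, $\Delta R^{\mathbf Y,\mathbf X}=R^{\mathbf Y,\mathbf X}-R^{\tilde{\mathbf Y},\tilde{\mathbf X}}$.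
   Formalization: The rough paths (X and 𝕏) and the controlled paths (Y, and Y' in operator norm) are assumed continuous; without this the claim fails, e.g. for X=0, 𝕏=0, Y'=0 and Y the indicator of a point. *)

(* Defs.v *)
From mathcomp Require Export all_boot all_order all_algebra.
From mathcomp Require Export all_classical all_reals all_analysis.
Export Order.TTheory GRing.Theory Num.Theory.
Export numFieldNormedType.Exports.

Set Implicit Arguments.
Unset Strict Implicit.
Unset Printing Implicit Defensive.

Local Open Scope classical_set_scope.
Local Open Scope ring_scope.

(* Two-parameter maps on the simplex 0 <= s <= t <= T are total functions of
   two reals; every definition below only uses their values on the simplex. *)
Definition simplex (R : realType) (T : R) : set (R * R) :=
  [set st | 0 <= st.1 /\ st.1 <= st.2 /\ st.2 <= T].

Section BesovVariation.
Context {R : realType}.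
Local Open Scope ereal_scope.

(* The L^p norm in s of chi(s, s+h) over [0, T-h]: the extension by 0 outside
   [0, T-h] lets Lnorm cover both p < +oo and p = +oo (essential supremum). *)
Definition besov_modulus (T : R) (p : \bar R) (chi : R -> R -> \bar R) (t : R)
    : \bar R :=
  ereal_sup [set 'N[lebesgue_measure]_p
                   [(fun s => chi s (s + h)%R) \_ `[0%R, (T - h)%R]]
            | h in `]0%R, t]].

(* For q = +oo the essential supremum is taken with respect to Lebesgue measure,
   which has the same null sets as dt/t on ]0, T]. *)
Definition besov_norm (T alpha : R) (p q : \bar R) (chi : R -> R -> \bar R)
    : \bar R :=
  let f t := besov_modulus T p chi t / (t `^ alpha)%:E in
  match q with
  | q%:E => (\int[lebesgue_measure]_(t in `]0%R, T]) (f t `^ q / t%:E)) `^ q^-1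
  | +oo => 'N[lebesgue_measure]_+oo [f \_ `]0%R, T]]
  | -oo => 0
  end.

Definition variation_sum (rho : R) (chi : R -> R -> \bar R) (pts : seq R)
    : \bar R :=
  \sum_(i < (size pts).-1) chi pts`_i pts`_i.+1 `^ rho.

Definition rho_variation (rho : R) (chi : R -> R -> \bar R) (s t : R) : \bar R :=
  (ereal_sup [set variation_sum rho chi pts
             | pts in [set pts : seq R |
                 sorted <%R pts /\ {subset pts <= `[s, t]}]]) `^ rho^-1.

Definition finite_variation (T rho : R) (chi : R -> R -> \bar R) : Prop :=
  rho_variation rho chi 0 T < +oo.

End BesovVariation.

Section Norms.
Context {R : realType}.

Definition norm2 (E : normedModType R) (A : R -> R -> E) : R -> R -> \bar R :=
  fun s t => `|A s t|%:E.

Definition incr (V : zmodType) (f : R -> V) : R -> R -> V :=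
  fun s t => f t - f s.

Context {E F : normedModType R}.

Definition bounded_linear (f : E -> F) : Prop :=
  linear f /\ exists M : R, forall x, `|f x| <= M * `|x|.

Definition opnorm (f : E -> F) : \bar R :=
  ereal_sup [set `|f x|%:E | x in [set x | `|x| <= 1]].

Definition opnorm2 (A : R -> R -> E -> F) : R -> R -> \bar R :=
  fun s t => opnorm (A s t).

End Norms.

(* (EE, tens) is a realisation of the algebraic tensor square of E, given by its
   universal property, with a norm on EE that is multiplicative on pure
   tensors. *)
Definition normed_tensor_square (R : realType) (E EE : normedModType R)
    (tens : {bilinear E -> E -> EE}) : Prop :=
  (forall (G : lmodType R) (b : {bilinear E -> E -> G}),
     exists2 L : {linear EE -> G},
       (forall x y, L (tens x y) = b x y) &
       (forall L' : {linear EE -> G},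
          (forall x y, L' (tens x y) = b x y) -> forall z, L' z = L z)) /\
  (forall x y : E, `|tens x y| = `|x| * `|y|).

Section RoughPaths.
Context {R : realType} {E EE F : normedModType R}.

Definition rough_path (T r : R) (tens : {bilinear E -> E -> EE})
    (X : R -> R -> E) (XX : R -> R -> EE) : Prop :=
  [/\ finite_variation T r (norm2 X),
      finite_variation T (r / 2) (norm2 XX),
      (forall s u t, 0 <= s -> s <= u -> u <= t -> t <= T ->
         X s t = X s u + X u t) &
      (forall s u t, 0 <= s -> s <= u -> u <= t -> t <= T ->
         XX s t = XX s u + XX u t + tens (X s u) (X u t))].

Definition remainder (X : R -> R -> E) (Y : R -> F) (Y' : R -> E -> F)
    : R -> R -> F :=
  fun s t => incr Y s t - Y' s (X s t).

Definition controlled_rough_path (T r : R) (X : R -> R -> E)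
    (Y : R -> F) (Y' : R -> E -> F) : Prop :=
  [/\ (forall t, 0 <= t <= T -> bounded_linear (Y' t)),
      finite_variation T r (opnorm2 (incr Y')) &
      finite_variation T (r / 2) (norm2 (remainder X Y Y'))].

(* Paths in the Besov scale are identified with their continuous
   representatives.  The choice of representative matters: for X = 0, Y' = 0
   and Y the indicator of one point, all Besov norms of X, Y' and of the
   remainder vanish, but those of the variation of the remainder do not. *)
Definition continuous_rough_path (T : R) (X : R -> R -> E) (XX : R -> R -> EE)
    : Prop :=
  {within simplex T, continuous (fun st => X st.1 st.2)} /\
  {within simplex T, continuous (fun st => XX st.1 st.2)}.

Definition continuous_controlled_path (T : R) (Y : R -> F) (Y' : R -> E -> F)
    : Prop :=
  {within `[0, T], continuous Y} /\
  (forall s, 0 <= s <= T ->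
     opnorm (Y' u - Y' s) @[u --> within `[0, T] (nbhs s)] --> 0%E).

End RoughPaths.

(* Main.v *)
Require Import Defs.
From mathcomp Require Import measurable_realfun ess_sup_inf.
From mathcomp Require Import ring lra zify.

Set Implicit Arguments.
Unset Strict Implicit.
Unset Printing Implicit Defensive.

Local Open Scope classical_set_scope.
Local Open Scope ring_scope.

(** Put rho = r/2 and a = 2 alpha, so that a rho > 1.

    Chen's relation, and the corresponding identity for the remainder of a
    controlled path, say that the function chi whose variation is to be bounded
    is additive up to a defect made of products of increments of paths: X times
    X for the second level, Y' times X for the remainder, and for differences
    the product rule X (x) X - X~ (x) X~ = DX (x) X + X~ (x) DX splits the
    defect into two products.  Hence all four estimates are instances of
    [variation_product_bound], which concerns
      chi(s,t) <= chi(s,u) + chi(u,t) + f1(s,u) g1(u,t) + f2(s,u) g2(u,t).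

    A product f(s,u) g(u,t) is at most h(s,u) h(u,t) with h = l f + g / l, and
    for the weight l that balances the two terms the norm of h^2 is comparable
    to the product of the norms of f and g ([product_control]).  This leaves a
    defect w(s,u) w(u,t) with one subadditive w, and the function
    g = chi + w^2, which dominates chi and w^2 and whose Besov norm is
    comparable to the right-hand side.

    Chaining: an interval [u,v] inside [s,s+h] is exhausted by dyadic intervals
    of [s,s+h], at most two of each level, so chi(u,v) is controlled as soon as
    w and chi decay geometrically in the level along the dyadic intervals
    inside [u,v] ([chain_bound]).  The size of this decay is measured by the
    weighted sum of g^rho over all these dyadic intervals.  That sum is
    superadditive as a function of the interval, so it bounds the sum of
    chi^rho over an arbitrary partition, and thus the rho-variation over
    [s,s+h] ([variation_le_energy]).

    Integration in s: a dyadic increment of level n is an increment of step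
    h/2^n, so the modulus of the variation at t is bounded by the moduli of g
    at t/2^n, n >= 0 ([modulus_bound]).  The 2^n intervals of level n cost a
    factor 2^(n/rho), where rho <= p is what allows to sum in l^rho under an
    L^p norm, while the weight t^-a gains 2^(-n a).  Since a > 1/rho, the
    scaling invariance of dt/t leaves a convergent geometric series
    ([besov_weight_hardy]), and [besov_variation_bound] follows. *)

(** * Dyadic points and chaining along them *)

Section Chaining.
Context {R : realType}.
Implicit Types (s h u v t z d : R) (n k N i j : nat).

Definition dyad s h n k : R := s + h * k%:R / 2 ^+ n.

Lemma dyad_double s h n k : dyad s h n.+1 k.*2 = dyad s h n k.
Proof.
rewrite /dyad -muln2 natrM exprSr; congr (_ + _).
have : (2 : R) ^+ n != 0 by rewrite expf_neq0.
by move=> ?; field; rewrite ?pnatr_eq0.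
Qed.

Lemma dyad_le s h n i j : 0 <= h -> (i <= j)%N -> dyad s h n i <= dyad s h n j.
Proof.
move=> h0 ij; rewrite lerD2l ler_pM2r ?invr_gt0 ?exprn_gt0//.
by rewrite ler_wpM2l// ler_nat.
Qed.

Lemma dyad_ge s h n k : 0 <= h -> s <= dyad s h n k.
Proof. by move=> h0; rewrite lerDl !mulr_ge0// invr_ge0 exprn_ge0. Qed.

Lemma dyad_top s h n : dyad s h n (2 ^ n) = s + h.
Proof. by rewrite /dyad natrX mulfK// expf_neq0. Qed.

Lemma dyadS s h n k : dyad s h n k.+1 = dyad s h n k + h / 2 ^+ n.
Proof. by rewrite /dyad -addn1 natrD mulrDr mulr1 mulrDl addrA. Qed.

Definition subadditive2 (T : R) (f : R -> R -> R) :=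
  forall s u t, 0 <= s -> s <= u -> u <= t -> t <= T -> f s t <= f s u + f u t.

Definition quasi_subadditive (T : R) (f w : R -> R -> R) :=
  forall s u t, 0 <= s -> s <= u -> u <= t -> t <= T ->
    f s t <= f s u + f u t + w s u * w u t.

Definition vanishes_on_diagonal (T : R) (f : R -> R -> R) :=
  forall s, 0 <= s <= T -> f s s = 0.

Definition nonneg2 (T : R) (f : R -> R -> R) :=
  forall s t, 0 <= s -> s <= t -> t <= T -> 0 <= f s t.

(** Rounding both ends of an index interval of level N + 1 inwards to even indices
    loses at most one interval of that level at each end. *)
Lemma dyadic_rounding i j N : (i < j)%N -> (j <= 2 ^ N.+1)%N ->
  let a := uphalf i in let b := j./2 in
  [/\ (i <= a.*2)%N, (a.*2 - i <= 1)%N, (b.*2 <= j)%N, (j - b.*2 <= 1)%N &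
      (a <= b)%N /\ (b <= 2 ^ N)%N].
Proof. by move=> ij; rewrite expnS => jN a b; rewrite /a /b; split; [lia..|split; lia]. Qed.

Lemma dyadic_step x y : (x <= y)%N -> (y - x <= 1)%N -> x != y -> y = x.+1.
Proof. lia. Qed.

Lemma dyadic_step0 i j : (j <= 2 ^ 0)%N -> (j - i <= 1)%N.
Proof. by rewrite expn0; lia. Qed.

Section Dyadic.
Variables (T s h z d : R) (f w : R -> R -> R).
Hypotheses (s0 : 0 <= s) (h0 : 0 <= h) (shT : s + h <= T).
Hypotheses (z0 : 0 < z) (z1 : z < 1) (d0 : 0 <= d).
Hypotheses (w0 : nonneg2 T w).
Hypotheses (wd : vanishes_on_diagonal T w) (fd : vanishes_on_diagonal T f).
Hypotheses (wS : subadditive2 T w) (fS : quasi_subadditive T f w).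

Local Notation P := (dyad s h).

Let P0 n k : 0 <= P n k. Proof. exact: le_trans s0 (dyad_ge _ _ _ h0). Qed.
Let PT n k : (k <= 2 ^ n)%N -> P n k <= T.
Proof. by move=> kn; apply: le_trans shT; rewrite -(dyad_top s h n) dyad_le. Qed.

Definition dyadic_bound (g : R -> R -> R) (c : R) u v N :=
  forall n k, (n <= N)%N -> u <= P n k -> P n k.+1 <= v ->
    g (P n k) (P n k.+1) <= c * z ^+ n.

Lemma dyadic_boundW g c u u' v v' N N' : u <= u' -> v' <= v -> (N' <= N)%N ->
  dyadic_bound g c u v N -> dyadic_bound g c u' v' N'.
Proof.
move=> uu vv NN H n k nN ku kv; apply: H; last 2 first.
- exact: le_trans ku. - exact: le_trans vv.
exact: leq_trans NN.
Qed.

Let geo_ge0 n : 0 <= (1 - z ^+ n) / (1 - z).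
Proof. by rewrite divr_ge0 ?subr_ge0 ?exprn_ile1 ?ltW. Qed.

Lemma dyadic_edge g c u v N x y : vanishes_on_diagonal T g -> 0 <= c ->
  dyadic_bound g c u v N -> u <= P N x -> P N y <= v ->
  (x <= y)%N -> (y <= 2 ^ N)%N -> (y - x <= 1)%N ->
  g (P N x) (P N y) <= c * z ^+ N.
Proof.
move=> gd c0 H ux yv xy yN; move=> yx; have [<-|nxy] := eqVneq x y.
  by rewrite gd ?mulr_ge0 ?exprn_ge0 ?(ltW z0)// P0 PT// (leq_trans xy).
by rewrite (dyadic_step xy yx nxy) in yv *; exact: H.
Qed.

(** The induction rounds the end points to the next coarser level, which adds at
    most two intervals of level N + 1; the bound is the partial geometric sum. *)
Lemma dyad_chain_path N i j : (i <= j)%N -> (j <= 2 ^ N)%N ->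
  dyadic_bound w d (P N i) (P N j) N ->
  w (P N i) (P N j) <= d * (2 * (1 - z ^+ N.+1) / (1 - z)).
Proof.
have z1' : 1 - z != 0 by rewrite subr_eq0 eq_sym lt_eqF.
elim: N i j => [|N IH] i j ij jN H.
  have -> : d * (2 * (1 - z ^+ 1) / (1 - z)) = 2 * d by field.
  suff : w (P 0 i) (P 0 j) <= d * z ^+ 0.
    by rewrite expr0 mulr1; have := d0 => *; clear H; lra.
  by apply: (dyadic_edge wd d0 H) => //; exact: dyadic_step0 jN.
have [<-|nij] := eqVneq i j.
  rewrite wd; last by rewrite P0 PT// (leq_trans ij).
  by rewrite -mulrA mulr_ge0// mulr_ge0.
have {nij}ij : (i < j)%N by rewrite ltn_neqAle nij.
have [ia ia1 bj bj1 [hij bN]] := dyadic_rounding ij jN.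
set a := uphalf i in ia ia1 hij; set b := j./2 in bj bj1 hij bN.
have ab : (a.*2 <= b.*2)%N by rewrite leq_double.
have ib := leq_trans ia ab; have aj := leq_trans ab bj.
have edge x y : (i <= x)%N -> (x <= y)%N -> (y <= j)%N -> (y - x <= 1)%N ->
    w (P N.+1 x) (P N.+1 y) <= d * z ^+ N.+1.
  move=> ix xy yj yx; apply: (dyadic_edge wd d0 H) => //; try exact: dyad_le.
  exact: leq_trans jN.
have da : P N a = P N.+1 a.*2 by rewrite dyad_double.
have db : P N b = P N.+1 b.*2 by rewrite dyad_double.
have Pi := P0 N.+1 i; have Pj := PT jN.
have Pia : P N.+1 i <= P N.+1 a.*2 by exact: dyad_le.
have Pab : P N.+1 a.*2 <= P N.+1 b.*2 by exact: dyad_le.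
have Pbj : P N.+1 b.*2 <= P N.+1 j by exact: dyad_le.
have e1 : w (P N.+1 i) (P N.+1 a.*2) <= d * z ^+ N.+1.
  exact: edge.
have e2 : w (P N.+1 b.*2) (P N.+1 j) <= d * z ^+ N.+1.
  exact: edge.
have e3 : w (P N.+1 a.*2) (P N.+1 b.*2) <= d * (2 * (1 - z ^+ N.+1) / (1 - z)).
  rewrite !dyad_double; apply: IH => //.
  by apply: dyadic_boundW H; rewrite ?da ?db.
have := wS Pi Pia (le_trans Pab Pbj) Pj.
have := wS (le_trans Pi Pia) Pab Pbj Pj.
have -> : d * (2 * (1 - z ^+ N.+2) / (1 - z)) =
   d * (2 * (1 - z ^+ N.+1) / (1 - z)) + 2 * (d * z ^+ N.+1).
  by rewrite [z ^+ N.+2]exprS; field.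
by clear H IH edge => *; lra.
Qed.

Lemma dyad_chain_pathW N i j : (i <= j)%N -> (j <= 2 ^ N)%N ->
  dyadic_bound w d (P N i) (P N j) N ->
  w (P N i) (P N j) <= d * (2 / (1 - z)).
Proof.
move=> ij jN H; apply: le_trans (dyad_chain_path ij jN H) _.
rewrite ler_wpM2l// ler_pM2r ?invr_gt0 ?subr_gt0//.
by rewrite ger_pMr// gerBl exprn_ge0// ltW.
Qed.

(** As for [w], but cutting off an end interval of level N + 1 also costs one
    product defect.  One of its factors is [w] on that interval, of order z^(N+1),
    the other is [w] on a long interval, which [dyad_chain_pathW] bounds uniformly.
    This is where the extra 4 / (1 - z) comes from. *)
Lemma dyad_chain N i j : (i <= j)%N -> (j <= 2 ^ N)%N ->
  dyadic_bound w d (P N i) (P N j) N ->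
  dyadic_bound f (d ^+ 2) (P N i) (P N j) N ->
  f (P N i) (P N j) <=
    d ^+ 2 * ((2 + 4 / (1 - z)) * (1 - z ^+ N.+1) / (1 - z)).
Proof.
have z1' : 1 - z != 0 by rewrite subr_eq0 eq_sym lt_eqF.
have zi : 0 < (1 - z)^-1 by rewrite invr_gt0 subr_gt0.
elim: N i j => [|N IH] i j ij jN Hw Hf.
  have -> : d ^+ 2 * ((2 + 4 / (1 - z)) * (1 - z ^+ 1) / (1 - z)) =
    d ^+ 2 * 2 + 4 * (d ^+ 2 * (1 - z)^-1) by field.
  have d20 : 0 <= d ^+ 2 by exact: exprn_ge0.
  have d2z : 0 <= d ^+ 2 * (1 - z)^-1 by rewrite mulr_ge0// ltW.
  suff : f (P 0 i) (P 0 j) <= d ^+ 2 * z ^+ 0.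
    by clear Hw Hf; rewrite expr0 mulr1 => ?; lra.
  by apply: (dyadic_edge fd d20 Hf) => //; exact: dyadic_step0 jN.
have [<-|nij] := eqVneq i j.
  rewrite fd; last by rewrite P0 PT// (leq_trans ij).
  have c0 : 0 <= 2 + 4 / (1 - z) by rewrite addr_ge0// mulr_ge0// ltW.
  by rewrite -mulrA mulr_ge0 ?exprn_ge0// mulr_ge0.
have {nij}ij : (i < j)%N by rewrite ltn_neqAle nij.
have [ia ia1 bj bj1 [hij bN]] := dyadic_rounding ij jN.
set a := uphalf i in ia ia1 hij; set b := j./2 in bj bj1 hij bN.
have ab : (a.*2 <= b.*2)%N by rewrite leq_double.
have ib := leq_trans ia ab; have aj := leq_trans ab bj.
have edge g c x y : vanishes_on_diagonal T g -> 0 <= c ->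
    dyadic_bound g c (P N.+1 i) (P N.+1 j) N.+1 ->
    (i <= x)%N -> (x <= y)%N -> (y <= j)%N -> (y - x <= 1)%N ->
    g (P N.+1 x) (P N.+1 y) <= c * z ^+ N.+1.
  move=> gd c0 H ix xy yj yx.
  by apply: (dyadic_edge gd c0 H) => //; rewrite ?dyad_le// (leq_trans yj).
have da : P N a = P N.+1 a.*2 by rewrite dyad_double.
have db : P N b = P N.+1 b.*2 by rewrite dyad_double.
have Pi := P0 N.+1 i; have Pj := PT jN.
have Pia : P N.+1 i <= P N.+1 a.*2 by exact: dyad_le.
have Pab : P N.+1 a.*2 <= P N.+1 b.*2 by exact: dyad_le.
have Pbj : P N.+1 b.*2 <= P N.+1 j by exact: dyad_le.
have zN : 0 <= z ^+ N.+1 by rewrite exprn_ge0// ltW.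
have e1 : f (P N.+1 i) (P N.+1 a.*2) <= d ^+ 2 * z ^+ N.+1.
  by apply: edge => //; rewrite exprn_ge0.
have e2 : f (P N.+1 b.*2) (P N.+1 j) <= d ^+ 2 * z ^+ N.+1.
  by apply: edge => //; rewrite exprn_ge0.
have e3 : f (P N.+1 a.*2) (P N.+1 b.*2) <=
    d ^+ 2 * ((2 + 4 / (1 - z)) * (1 - z ^+ N.+1) / (1 - z)).
  rewrite !dyad_double; apply: IH => //.
    by apply: dyadic_boundW Hw; rewrite ?da ?db.
  by apply: dyadic_boundW Hf; rewrite ?da ?db.
have PbT := le_trans Pbj Pj; have PaT := le_trans Pab PbT.
have e4 : w (P N.+1 i) (P N.+1 a.*2) * w (P N.+1 a.*2) (P N.+1 j) <=
    d ^+ 2 * z ^+ N.+1 * (2 / (1 - z)).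
  have -> : d ^+ 2 * z ^+ N.+1 * (2 / (1 - z)) =
    (d * z ^+ N.+1) * (d * (2 / (1 - z))) by field.
  apply: ler_pM.
  - exact: w0 (P0 _ _) Pia PaT.
  - exact: w0 (P0 _ _) (le_trans Pab Pbj) Pj.
  - exact: edge.
  - by apply: dyad_chain_pathW => //; exact: dyadic_boundW Hw.
have e5 : w (P N.+1 a.*2) (P N.+1 b.*2) * w (P N.+1 b.*2) (P N.+1 j) <=
    d ^+ 2 * z ^+ N.+1 * (2 / (1 - z)).
  have -> : d ^+ 2 * z ^+ N.+1 * (2 / (1 - z)) =
    (d * (2 / (1 - z))) * (d * z ^+ N.+1) by field.
  apply: ler_pM.
  - exact: w0 (P0 _ _) Pab PbT.
  - exact: w0 (P0 _ _) Pbj Pj.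
  - apply: dyad_chain_pathW => //; first exact: leq_trans bj jN.
    exact: dyadic_boundW Hw.
  - exact: edge.
have := fS Pi Pia (le_trans Pab Pbj) Pj.
have := fS (le_trans Pi Pia) Pab Pbj Pj.
have -> : d ^+ 2 * ((2 + 4 / (1 - z)) * (1 - z ^+ N.+2) / (1 - z)) =
   d ^+ 2 * ((2 + 4 / (1 - z)) * (1 - z ^+ N.+1) / (1 - z)) +
   2 * (d ^+ 2 * z ^+ N.+1) + 2 * (d ^+ 2 * z ^+ N.+1 * (2 / (1 - z))).
  by rewrite [z ^+ N.+2]exprS; field.
by clear Hw Hf IH edge => *; lra.
Qed.

End Dyadic.
End Chaining.

(** * From dyadic intervals to all intervals *)

Section Approx.
Context {R : realType}.
Implicit Types (s h u v t z d : R) (n k N i j : nat).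

Definition continuous2 (T : R) (f : R -> R -> R) :=
  {within simplex T, continuous (fun st => f st.1 st.2)}.

Lemma continuous2_near T (f : R -> R -> R) u v M : continuous2 T f ->
  0 <= u -> u <= v -> v <= T -> M < f u v ->
  exists2 e : R, 0 < e & forall a b, 0 <= a -> a <= b -> b <= T ->
    `|u - a| < e -> `|v - b| < e -> M < f a b.
Proof.
move=> /subspace_continuousP fc u0 uv vT Mf.
have /fc/cvgr_gt/(_ _ Mf) : simplex T (u, v) by [].
rewrite near_withinE => /nbhs_ballP[e /= e0 H].
exists e => // a b a0 ab bT ua vb.
by apply: (H (a, b)).
Qed.

Lemma dyad_fine h e : 0 < e -> exists N : nat, h / 2 ^+ N < e.
Proof.
move=> e0; have [N hN] : exists N : nat, h / e < N%:R.
  by exists (Num.truncn (h / e)).+1; rewrite truncnS_gt.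
exists N; rewrite ltr_pdivrMr ?exprn_gt0// mulrC -ltr_pdivrMr//.
by apply: lt_le_trans hN _; rewrite -natrX ler_nat ltnW// ltn_expl.
Qed.

(** Interior approximation: the dyadic interval stays inside [u, v], so that bounds
    known for the dyadic intervals inside [u, v] apply to it. *)
Lemma dyad_approx s h u v e : 0 < h -> s <= u -> u < v -> v <= s + h -> 0 < e ->
  exists N i j, [/\ (i <= j)%N, (j <= 2 ^ N)%N,
    u <= dyad s h N i < u + e & v - e < dyad s h N j <= v].
Proof.
move=> h0 su uv vsh e0.
have m0 : 0 < Num.min e ((v - u) / 2) by rewrite lt_min e0 divr_gt0// subr_gt0.
have [N] := dyad_fine h m0; rewrite lt_min => /andP[hNe hNu].
(* The first dyadic point to the right of u and the last one to the left of v. *)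
have Pi : exists i, u <= dyad s h N i.
  by exists (2 ^ N)%N; rewrite dyad_top (le_trans (ltW uv)).
case: (ex_minnP Pi) => i ui imin.
have Pj : exists j, (j <= 2 ^ N)%N && (dyad s h N j <= v).
  by exists 0%N; rewrite leq0n /dyad mulr0 mul0r addr0 (le_trans su (ltW uv)).
have Pjb j : (j <= 2 ^ N)%N && (dyad s h N j <= v) -> (j <= 2 ^ N)%N by case/andP.
case: (ex_maxnP Pj Pjb) => j /andP[jN jv] jmax.
have iu : dyad s h N i < u + h / 2 ^+ N.
  case: i ui imin => [|i] ui imin.
    rewrite /dyad mulr0 mul0r addr0 -subr_gt0.
    have : 0 < h / 2 ^+ N by rewrite divr_gt0// exprn_gt0.
    by move: su; lra.
  rewrite dyadS ltrD2r ltNge; by apply/negP => /imin; rewrite ltnn.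
have vj : v - h / 2 ^+ N < dyad s h N j.
  have [jlt|] := ltnP j (2 ^ N); last first.
    move=> Nj; have -> : j = (2 ^ N)%N by apply/eqP; rewrite eqn_leq jN.
    by rewrite dyad_top (lt_le_trans _ vsh)// gtrBl divr_gt0// exprn_gt0.
  rewrite ltrBlDr -dyadS ltNge; apply/negP => jv'.
  by have := jmax j.+1; rewrite jlt jv' ltnn => /(_ isT).
exists N, i, j; split => //.
- rewrite leqNgt; apply/negP => ji.
  have := dyad_le s N (ltW h0) (ltnW ji).
  move: iu vj hNu; clear; lra.
- by rewrite ui; move: iu hNe; clear; lra.
- by rewrite jv andbT; move: vj hNe; clear; lra.
Qed.

(** If the bound failed, continuity would make it fail on a dyadic interval inside
    [u, v], against [dyad_chain]; the bound does not depend on the level. *)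
Lemma chain_bound T s h z d (f w : R -> R -> R) u v :
  0 <= s -> 0 < h -> s + h <= T -> 0 < z -> z < 1 -> 0 <= d ->
  nonneg2 T w ->
  vanishes_on_diagonal T w -> vanishes_on_diagonal T f ->
  subadditive2 T w -> quasi_subadditive T f w ->
  continuous2 T f ->
  s <= u -> u < v -> v <= s + h ->
  (forall N, dyadic_bound s h z w d u v N) ->
  (forall N, dyadic_bound s h z f (d ^+ 2) u v N) ->
  f u v <= d ^+ 2 * ((2 + 4 / (1 - z)) / (1 - z)).
Proof.
move=> s0 h0 shT z0 z1 d0 w0 wd fd wS fS fc su uv vsh Hw Hf.
rewrite leNgt; apply/negP => Mf.
have u0 := le_trans s0 su; have vT := le_trans vsh shT.
have [e e0 He] := continuous2_near fc u0 (ltW uv) vT Mf.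
have [N [i [j [ij jN /andP[ui iu] /andP[vj jv]]]]] := dyad_approx h0 su uv vsh e0.
have Pij := dyad_le s N (ltW h0) ij.
have := He _ _ (le_trans u0 ui) Pij (le_trans jv vT).
have -> : `|u - dyad s h N i| < e by rewrite ler0_norm ?subr_le0// opprB ltrBlDl.
have -> : `|v - dyad s h N j| < e.
  by rewrite ger0_norm ?subr_ge0// ltrBlDl -ltrBlDr.
move=> /(_ isT isT); rewrite ltNge => /negP; apply.
have H1 : dyadic_bound s h z w d (dyad s h N i) (dyad s h N j) N.
  exact: dyadic_boundW (Hw N).
have H2 : dyadic_bound s h z f (d ^+ 2) (dyad s h N i) (dyad s h N j) N.
  exact: dyadic_boundW (Hf N).
apply: le_trans (dyad_chain s0 (ltW h0) shT z0 z1 d0 w0 wd fd wS fS ij jN H1 H2) _.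
have z1' : 0 < 1 - z by rewrite subr_gt0.
rewrite ler_wpM2l ?exprn_ge0// ler_pM2r ?invr_gt0//.
rewrite ger_pMr ?gerBl ?exprn_ge0 ?(ltW z0)//.
by rewrite addr_gt0// divr_gt0.
Qed.

End Approx.

(** * A superadditive energy that controls the variation *)

Section Energy.
Context {R : realType}.
Implicit Types (s h u v t z d : R) (n k N i j : nat).

Lemma powRX z r n : 0 <= z -> (z ^+ n) `^ r = (z `^ r) ^+ n.
Proof.
move=> z0; elim: n => [|n IH]; first by rewrite !expr0 powR1.
by rewrite !exprS powRM ?exprn_ge0// IH.
Qed.

Lemma le_poweR r : 0 <= r -> forall x y : \bar R, (0 <= x)%E -> (x <= y)%E ->
  (x `^ r <= y `^ r)%E.
Proof.
move=> r0 x y x0 xy; apply: gt0_ler_poweR => //.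
- by rewrite in_itv/= x0 leey.
- by rewrite in_itv/= (le_trans x0 xy) leey.
Qed.

(** Only the dyadic intervals inside [u, v] count, which makes the sum superadditive
    in the interval. *)
Definition dyadic_term s h c rho (f : R -> R -> R) u v n : R :=
  \sum_(k < 2 ^ n | (u <= dyad s h n k) && (dyad s h n k.+1 <= v))
     c ^+ n * f (dyad s h n k) (dyad s h n k.+1) `^ rho.

Definition dyadic_energy s h c rho (f : R -> R -> R) u v : \bar R :=
  (\sum_(n <oo) (dyadic_term s h c rho f u v n)%:E)%E.

Lemma dyadic_term_ge0 s h c rho f u v n : 0 <= c ->
  0 <= dyadic_term s h c rho f u v n.
Proof.
by move=> c0; apply: sumr_ge0 => k _; rewrite mulr_ge0 ?exprn_ge0 ?powR_ge0.
Qed.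

Lemma dyadic_energy_ge0 s h c rho f u v : 0 <= c ->
  (0 <= dyadic_energy s h c rho f u v)%E.
Proof. by move=> c0; apply: nneseries_ge0 => n _ _; rewrite lee_fin dyadic_term_ge0. Qed.

(** A dyadic interval has positive length, so it cannot lie in both of two adjacent
    intervals. *)
Lemma dyadic_term_superadd s h c rho f u v x n : 0 < h -> 0 <= c ->
  u <= v -> v <= x ->
  dyadic_term s h c rho f u v n + dyadic_term s h c rho f v x n <=
  dyadic_term s h c rho f u x n.
Proof.
move=> h0 c0 uv vx; rewrite /dyadic_term [X in X + _]big_mkcond.
rewrite [X in _ + X]big_mkcond [leRHS]big_mkcond -big_split/=.
apply: ler_sum => k _.
have t0 : 0 <= c ^+ n * f (dyad s h n k) (dyad s h n k.+1) `^ rho.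
  by rewrite mulr_ge0 ?exprn_ge0 ?powR_ge0.
have lt_k : dyad s h n k < dyad s h n k.+1.
  by rewrite dyadS ltrDl divr_gt0// exprn_gt0.
case: ifPn => [/andP[ul lv]|_]; case: ifPn => [/andP[vl lx]|_].
- by have := lt_le_trans lt_k (le_trans lv vl); rewrite ltxx.
- by rewrite ul (le_trans lv vx)/= addr0.
- by rewrite (le_trans uv vl) lx/= add0r.
- by rewrite addr0; case: ifP.
Qed.

Lemma dyadic_energy_superadd s h c rho f u v x : 0 < h -> 0 <= c ->
  u <= v -> v <= x ->
  (dyadic_energy s h c rho f u v + dyadic_energy s h c rho f v x <=
   dyadic_energy s h c rho f u x)%E.
Proof.
move=> h0 c0 uv vx; rewrite /dyadic_energy -nneseriesD//; last 2 first.
- by move=> n _ _; rewrite lee_fin dyadic_term_ge0.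
- by move=> n _ _; rewrite lee_fin dyadic_term_ge0.
apply: lee_nneseries => n _; first by rewrite -EFinD lee_fin addr_ge0// dyadic_term_ge0.
by rewrite -EFinD lee_fin dyadic_term_superadd.
Qed.

Lemma dyadic_energy_term s h c rho (f : R -> R -> R) u v n k : 0 <= c -> 0 < h ->
  v <= s + h -> u <= dyad s h n k -> dyad s h n k.+1 <= v ->
  ((c ^+ n * f (dyad s h n k) (dyad s h n k.+1) `^ rho)%:E <=
   dyadic_energy s h c rho f u v)%E.
Proof.
move=> c0 h0 vsh uk kv.
have kn : (k < 2 ^ n)%N.
  rewrite ltnNge; apply/negP => nk.
  have := le_trans kv vsh; rewrite -(dyad_top s h n) dyadS leNgt => /negP; apply.
  by rewrite ltr_pwDr ?divr_gt0 ?exprn_gt0//; exact: dyad_le (ltW h0) nk.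
have t0 (l : nat) : 0 <= c ^+ n * f (dyad s h n l) (dyad s h n l.+1) `^ rho.
  by rewrite mulr_ge0 ?exprn_ge0 ?powR_ge0.
apply: (@le_trans _ _ (dyadic_term s h c rho f u v n)%:E).
  rewrite lee_fin /dyadic_term (bigD1 (Ordinal kn)) ?uk//= lerDl.
  by apply: sumr_ge0 => l _; exact: t0.
rewrite /dyadic_energy (nneseriesD1 (n := n))//=.
  rewrite leeDl// nneseries_ge0// => m _ _; rewrite lee_fin dyadic_term_ge0//.
by move=> m _; rewrite lee_fin dyadic_term_ge0.
Qed.

Definition chain_const z : R := (2 + 4 / (1 - z)) / (1 - z).

Lemma chain_const_gt0 z : z < 1 -> 0 < chain_const z.
Proof.
move=> z1; have z1' : 0 < 1 - z by rewrite subr_gt0.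
by rewrite divr_gt0// addr_gt0// divr_gt0.
Qed.

Section Variation.
Variables (T z rho : R) (f w g : R -> R -> R).
Hypotheses (z0 : 0 < z) (z1 : z < 1) (rho0 : 0 < rho).
Hypotheses (w0 : nonneg2 T w) (f0 : nonneg2 T f).
Hypotheses (wd : vanishes_on_diagonal T w) (fd : vanishes_on_diagonal T f).
Hypotheses (wS : subadditive2 T w) (fS : quasi_subadditive T f w).
Hypothesis fc : continuous2 T f.
Hypothesis fg : forall s t, 0 <= s -> s <= t -> t <= T -> f s t <= g s t.
Hypothesis wg : forall s t, 0 <= s -> s <= t -> t <= T -> w s t ^+ 2 <= g s t.

(* With the weight c^n the energy E gives g <= E^(1/rho) z^(2n) on level n, that
   is, w <= d z^n and f <= d^2 z^n with d^2 = E^(1/rho). *)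
Local Notation c := ((z ^+ 2) `^ rho)^-1.

Lemma increment_le_energy s h u v : 0 <= s -> 0 < h -> s + h <= T ->
  s <= u -> u < v -> v <= s + h ->
  ((f u v `^ rho)%:E <=
     (chain_const z `^ rho)%:E * dyadic_energy s h c rho g u v)%E.
Proof.
move=> s0 h0 shT su uv vsh.
have c0 : 0 < c by rewrite invr_gt0 powR_gt0// exprn_gt0.
have K0 := chain_const_gt0 z1.
have := dyadic_energy_ge0 s h rho g u v (ltW c0).
case eD : (dyadic_energy s h c rho g u v) => [D| |] // D0; last first.
  by rewrite gt0_muley ?leey// lte_fin powR_gt0.
rewrite -EFinM lee_fin; rewrite lee_fin in D0.
pose d := Num.sqrt (D `^ rho^-1).
have d2 : d ^+ 2 = D `^ rho^-1 by rewrite sqr_sqrtr// powR_ge0.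
have u0 := le_trans s0 su; have vT := le_trans vsh shT.
have gd n k : u <= dyad s h n k -> dyad s h n k.+1 <= v ->
    g (dyad s h n k) (dyad s h n k.+1) <= d ^+ 2 * (z ^+ n) ^+ 2.
  move=> uk kv.
  have gk0 : 0 <= g (dyad s h n k) (dyad s h n k.+1).
    apply: le_trans (f0 _ _ _) (fg _ _ _); rewrite ?(le_trans u0)//;
     rewrite ?dyad_le ?(ltW h0)//; exact: le_trans vT.
  have := dyadic_energy_term rho g (ltW c0) h0 vsh uk kv.
  rewrite eD lee_fin exprVn ler_pdivrMl ?exprn_gt0 ?powR_gt0 ?exprn_gt0// => H.
  have -> : g (dyad s h n k) (dyad s h n k.+1) =
      (g (dyad s h n k) (dyad s h n k.+1) `^ rho) `^ rho^-1.
    by rewrite -powRrM mulfV ?powRr1// gt_eqF.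
  apply: (le_trans (ge0_ler_powR _ _ _ H));
    rewrite ?nnegrE ?invr_ge0 ?(ltW rho0) ?powR_ge0//.
    by rewrite mulr_ge0 ?exprn_ge0 ?powR_ge0.
  rewrite powRM ?exprn_ge0 ?powR_ge0// mulrC -powRX ?exprn_ge0 ?(ltW z0)//.
  by rewrite -powRrM mulfV ?gt_eqF// powRr1 ?exprn_ge0 ?(ltW z0)// d2 -!exprM mulnC.
have zn n : 0 <= z ^+ n <= 1 by rewrite exprn_ge0 ?exprn_ile1// ltW.
have J n k : u <= dyad s h n k -> dyad s h n k.+1 <= v ->
    [/\ 0 <= dyad s h n k, dyad s h n k <= dyad s h n k.+1 & dyad s h n k.+1 <= T].
  move=> uk kv; split; [exact: le_trans uk|exact: dyad_le (ltW h0) _|].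
  exact: le_trans vT.
have fuv : f u v <= d ^+ 2 * chain_const z.
  apply: (chain_bound s0 h0 shT z0 z1 (sqrtr_ge0 _) w0 wd fd wS fS fc su uv vsh).
  - move=> N n k _ uk kv; have [k0 kk kT] := J _ _ uk kv.
    rewrite -(@ler_pXn2r _ 2)// ?nnegrE ?w0// ?mulr_ge0 ?sqrtr_ge0//; last first.
      by case/andP: (zn n).
    rewrite exprMn; apply: le_trans (gd _ _ uk kv); exact: wg.
  - move=> N n k _ uk kv; have [k0 kk kT] := J _ _ uk kv.
    apply: (le_trans (fg k0 kk kT)); apply: (le_trans (gd _ _ uk kv)).
    rewrite ler_wpM2l ?exprn_ge0 ?sqrtr_ge0// expr2.
    by case/andP: (zn n) => *; rewrite ler_piMl.
have fuv0 : 0 <= f u v by rewrite f0// ltW.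
apply: le_trans (ge0_ler_powR (ltW rho0) _ _ fuv) _; rewrite ?nnegrE//.
  by rewrite mulr_ge0 ?exprn_ge0 ?sqrtr_ge0// ltW.
rewrite powRM ?exprn_ge0 ?sqrtr_ge0 ?(ltW K0)// d2 -powRrM mulVf ?gt_eqF//.
by rewrite powRr1// mulrC.
Qed.

(** By superadditivity the bound for one increment, summed over any partition, is
    still bounded by the energy of the whole interval. *)
Lemma variation_le_energy s h : 0 <= s -> 0 < h -> s + h <= T ->
  (rho_variation rho (fun a b => (f a b)%:E) s (s + h) <=
    ((chain_const z `^ rho)%:E * dyadic_energy s h c rho g s (s + h)) `^ rho^-1)%E.
Proof.
move=> s0 h0 shT.
have c0 : 0 <= c by rewrite invr_ge0 powR_ge0.
have E0 u v := dyadic_energy_ge0 s h rho g u v c0.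
have K0 : (0 <= (chain_const z `^ rho)%:E)%E by rewrite lee_fin powR_ge0.
apply: le_poweR; first by rewrite invr_ge0 ltW.
  apply: le_trans (ereal_sup_ubound _); last first.
    by exists [::]; split.
  by rewrite /variation_sum big_ord0.
apply: ge_ereal_sup => _ [pts [spts ptsin] <-].
suff main x l : path <%R x l -> {subset x :: l <= `[s, s + h]} ->
    (variation_sum rho (fun a b => (f a b)%:E) (x :: l) <=
     (chain_const z `^ rho)%:E * dyadic_energy s h c rho g x (s + h))%E.
  case: pts spts ptsin => [|x l] spts ptsin.
    by rewrite /variation_sum big_ord0 mule_ge0.
  apply: (le_trans (main _ _ spts ptsin)); apply: lee_wpmul2l => //.
  have /andP[sx xs] : s <= x <= s + h by have := ptsin x (mem_head _ _); rewrite in_itv.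
  by apply: le_trans (dyadic_energy_superadd _ _ _ h0 c0 sx xs); rewrite leeDr.
elim: l x => [|y l IH] x; first by rewrite /variation_sum big_ord0 mule_ge0.
move=> /= /andP[xy pyl] sub.
have sub' : {subset y :: l <= `[s, s + h]} by move=> a al; apply: sub; rewrite inE al orbT.
have := sub x (mem_head _ _); rewrite in_itv => /andP[sx xs].
have := sub' y (mem_head _ _); rewrite in_itv => /andP[sy ys].
rewrite /variation_sum/= big_ord_recl/=.
have := IH _ pyl sub'; rewrite /variation_sum/= => IHy.
apply: (le_trans (leeD (increment_le_energy s0 h0 shT sx xy ys) IHy)).
rewrite -ge0_muleDr//; apply: lee_wpmul2l => //.
exact: (dyadic_energy_superadd _ _ _ h0 c0 (ltW xy) ys).
Qed.

End Variation.
End Energy.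

(** * Integrals, geometric series and power means *)

Section Tools.
Context {R : realType}.
Local Notation leb := (@lebesgue_measure R).

(** The integral of a nonnegative function is a supremum over simple functions below
    it, hence monotone on all nonnegative functions.  This allows to integrate
    the variation without discussing its measurability. *)
Lemma ge0_le_lower_integral d (X : measurableType d)
    (mu : {measure set X -> \bar R}) (D : set X) (f g : X -> \bar R) :
  (forall x, D x -> (0 <= f x)%E) -> (forall x, D x -> (f x <= g x)%E) ->
  (\int[mu]_(x in D) f x <= \int[mu]_(x in D) g x)%E.
Proof.
move=> f0 fg.
have g0 x : D x -> (0 <= g x)%E by move=> Dx; exact: le_trans (f0 _ Dx) (fg _ Dx).
rewrite !ge0_integralE//; apply: ereal_sup_le => _ [h hf <-]; exists h => // x.
apply: le_trans (hf x) _; rewrite /patch; case: ifPn => // /set_mem; exact: fg.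
Qed.

Lemma affine_preimage_itvoc (a c : R) (x y : R) : 0 < c ->
  (fun s => a + c * s) @^-1` `]x, y] = `](x - a) / c, (y - a) / c]%classic.
Proof.
move=> c0; apply/seteqP; split => s /=; rewrite !in_itv/= => /andP[xs sy].
- by rewrite ltr_pdivrMr// ler_pdivlMr// ltrBlDl lerBrDl mulrC xs sy.
- move: xs sy; rewrite ltr_pdivrMr// ler_pdivlMr// ltrBlDl lerBrDl mulrC.
  by move=> -> ->.
Qed.

Lemma measurable_affine (a c : R) :
  measurable_fun setT
    (fun s : measurableTypeR R => a + c * (s : R) : measurableTypeR R).
Proof.
have : measurable_fun setT (fun s : R => a + c * s).
  by apply: measurable_funD => //; exact: measurable_funM.
by [].
Qed.

(** Multiplied by c, the image of Lebesgue measure under s -> a + c s has the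
    right value on half-open intervals, which determine it. *)
Lemma lebesgue_affine (a c : R) (A : set R) : 0 < c -> measurable A ->
  (c%:E * leb ((fun s => (a + c * s)%R) @^-1` A))%E = leb A.
Proof.
move=> c0 mA.
pose phi := fun s : measurableTypeR R => a + c * (s : R) : measurableTypeR R.
pose mu' := pushforward leb phi : {measure set (measurableTypeR R) -> \bar R}.
pose mu := mu' (measurable_affine a c).
pose k : {nonneg R} := NngNum (ltW c0).
transitivity (mscale k mu A); first by [].
apply/esym.
apply: (@lebesgue_measure_unique _ (mscale k mu)) => //= _ [[x y] _ <-].
rewrite /mscale/= /mu /pushforward /phi affine_preimage_itvoc//=.
rewrite !lebesgue_measure_itv/= !lte_fin ltr_pM2r ?invr_gt0// ltrD2r.
case: ifPn => xy; last by rewrite mule0.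
by rewrite -EFinM -EFinD -mulrBl opprB addrA subrK mulrC divfK// gt_eqF.
Qed.

Lemma integral_affine (a c : R) (D : set R) (f : R -> \bar R) : 0 < c ->
  measurable D -> measurable_fun D f -> (forall x, D x -> 0 <= f x)%E ->
  (c%:E * \int[leb]_(s in (fun s => (a + c * s)%R) @^-1` D) f (a + c * s)%R)%E =
  (\int[leb]_(s in D) f s)%E.
Proof.
move=> c0 mD mf f0.
pose phi := fun s : measurableTypeR R => a + c * (s : R) : measurableTypeR R.
pose k : {nonneg R} := NngNum (ltW c0).
have := @ge0_integral_pushforward _ _ _ _ _ _ (measurable_affine a c) leb D f mD mf.
rewrite /comp => <-; last by move=> x /set_mem; exact: f0.
pose mu' := pushforward leb phi : {measure set (measurableTypeR R) -> \bar R}.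
pose mu := mu' (measurable_affine a c).
have <- := @ge0_integral_mscale _ _ _ mu D mD k f mf f0.
by apply: eq_measure_integral => A mA _; exact: lebesgue_affine.
Qed.

Lemma nneseries_le_geometric (x : nat -> \bar R) (A k : R) :
  0 <= k -> k < 1 -> 0 <= A -> (forall n, 0 <= x n)%E ->
  (forall n, (x n <= (A * k ^+ n)%:E)%E) ->
  (\sum_(n <oo) x n <= (A / (1 - k))%:E)%E.
Proof.
move=> k0 k1 A0 x0 xA.
have k1' : 1 - k != 0 by rewrite subr_eq0 eq_sym lt_eqF.
apply: lime_le; first exact: is_cvg_nneseries.
apply: nearW => n.
apply: (@le_trans _ _ (\sum_(0 <= i < n) (A * k ^+ i)%:E)%E).
  by apply: lee_sum => i _.
rewrite sumEFin lee_fin.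
have -> : \sum_(0 <= i < n) (A * k ^+ i) = A * (1 - k ^+ n) / (1 - k).
  elim: n => [|n IH]; first by rewrite big_nil expr0 subrr mulr0 mul0r.
  by rewrite big_nat_recr//= IH exprS; field.
rewrite ler_pM2r ?invr_gt0 ?subr_gt0// ler_piMr// gerBl exprn_ge0//.
Qed.

(** Jensen for the average of N numbers.  With mu the average, Young's inequality
    for a_k mu^(m-1) summed over k gives it. *)
Lemma powR_sum_le (N : nat) (a : nat -> R) (m : R) : (0 < N)%N -> 1 <= m ->
  (forall k, 0 <= a k) ->
  ((\sum_(k < N) a k) / N%:R) `^ m <= (\sum_(k < N) a k `^ m) / N%:R.
Proof.
move=> N0 m1 a0; have NR : 0 < N%:R :> R by rewrite ltr0n.
have S0 : 0 <= (\sum_(k < N) a k) / N%:R by rewrite divr_ge0 ?sumr_ge0// ltW.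
have [->|nm1] := eqVneq m 1.
  by rewrite powRr1//; under [in leRHS]eq_bigr do rewrite powRr1//.
have {nm1}m1' : 1 < m by rewrite lt_neqAle eq_sym nm1.
have m0 : 0 < m by exact: lt_trans m1'.
set mu := _ / N%:R in S0 *.
have SN : \sum_(k < N) a k = mu * N%:R by rewrite /mu divfK// gt_eqF.
have q0 : 0 < m / (m - 1) by rewrite divr_gt0// subr_gt0.
have pq : m^-1 + (m / (m - 1))^-1 = 1.
  by rewrite invf_div -[X in X + _]div1r -mulrDl subrKC mulfV// gt_eqF.
have muq : (mu `^ (m - 1)) `^ (m / (m - 1)) = mu `^ m.
  by rewrite -powRrM mulrC divfK// gt_eqF// subr_gt0.
have mum : mu * mu `^ (m - 1) = mu `^ m.
  rewrite -{1}(powRr1 S0) -powRD; first by rewrite addrC subrK.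
  by apply/implyP => /eqP; rewrite addrC subrK => m00; rewrite m00 ltxx in m0.
have Y k : a k * mu `^ (m - 1) <= a k `^ m / m + mu `^ m / (m / (m - 1)).
  by rewrite -muq; apply: conjugate_powR => //; rewrite powR_ge0.
have : \sum_(k < N) (a k * mu `^ (m - 1)) <=
       \sum_(k < N) (a k `^ m / m + mu `^ m / (m / (m - 1))).
  by apply: ler_sum => k _; exact: Y.
rewrite -mulr_suml SN mulrAC mum big_split/= -mulr_suml sumr_const card_ord.
rewrite -[X in _ <= _ + X]mulr_natr -lerBlDr.
have -> : mu `^ m * N%:R - mu `^ m / (m / (m - 1)) * N%:R = mu `^ m * N%:R / m.
  have m10 : m - 1 != 0 by rewrite gt_eqF// subr_gt0.
  have m00 : m != 0 by rewrite gt_eqF.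
  by field; rewrite m10 m00.
by rewrite ler_pM2r ?invr_gt0// ler_pdivlMr.
Qed.

Lemma powR_inv (a r : R) : 0 <= a -> a^-1 `^ r = (a `^ r)^-1.
Proof. by move=> a0; rewrite -powR_inv1// -powRrM mulN1r powRN. Qed.

(** The power m can be moved inside a double sum with 2^n terms at level n if the
    weight x^n leaves room: by the power mean inequality the inner sum is at most
    kap^n times the m-th root of the right-hand series, and kap < 1. *)
Lemma nneseries_dyadic_powR (b : nat -> nat -> R) (c x m : R) :
  0 < c -> 0 < x -> 1 <= m -> (forall n k, 0 <= b n k) ->
  let kap := c * 2 * ((2 * x) `^ m^-1)^-1 in kap < 1 ->
  ((\sum_(n <oo) (\sum_(k < 2 ^ n) c ^+ n * b n k)%:E) `^ m <=
   ((1 - kap) `^ (- m))%:E *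
     \sum_(n <oo) (\sum_(k < 2 ^ n) x ^+ n * b n k `^ m)%:E)%E.
Proof.
move=> c0 x0 m1 b0 kap kap1; have m0 : 0 < m by exact: lt_le_trans m1.
have mn0 : m != 0 by rewrite gt_eqF.
have kap0 : 0 <= kap by rewrite !mulr_ge0 ?invr_ge0 ?powR_ge0// ltW.
have t0 n : 0 <= \sum_(k < 2 ^ n) x ^+ n * b n k `^ m.
  by apply: sumr_ge0 => k _; rewrite mulr_ge0 ?powR_ge0// exprn_ge0// ltW.
have s0 n : 0 <= \sum_(k < 2 ^ n) c ^+ n * b n k.
  by apply: sumr_ge0 => k _; rewrite mulr_ge0// exprn_ge0// ltW.
have k1 : 0 < 1 - kap by rewrite subr_gt0.
have : (0 <= \sum_(n <oo) (\sum_(k < 2 ^ n) x ^+ n * b n k `^ m)%:E)%E.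
  by apply: nneseries_ge0 => n _ _; rewrite lee_fin t0.
case eD : (\sum_(n <oo) _)%E => [D| |]// D0; last first.
  by rewrite gt0_muley ?leey// lte_fin powR_gt0.
rewrite lee_fin in D0.
have H n : \sum_(k < 2 ^ n) c ^+ n * b n k <= D `^ m^-1 * kap ^+ n.
  have Dn : \sum_(k < 2 ^ n) x ^+ n * b n k `^ m <= D.
    rewrite -lee_fin -eD (nneseriesD1 (n := n))//=; last first.
      by move=> ? _; rewrite lee_fin t0.
    by rewrite leeDl// nneseries_ge0// => ? _ _; rewrite lee_fin t0.
  have N0 : (0 < 2 ^ n)%N by rewrite expn_gt0.
  have := powR_sum_le N0 m1 (b0 n).
  set B := \sum_(k < _) b n k; set Bm := \sum_(k < _) b n k `^ m.
  have xn0 : 0 < x ^+ n by exact: exprn_gt0.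
  rewrite natrX => H.
  have {}H : (B / 2 ^+ n) `^ m <= D / (2 * x) ^+ n.
    apply: (le_trans H); rewrite exprMn invfM mulrCA.
    rewrite [Bm / _]mulrC ler_pM2l ?invr_gt0 ?exprn_gt0// ler_pdivlMr//.
    by rewrite mulrC /Bm mulr_sumr.
  have B0 : 0 <= B / 2 ^+ n by rewrite divr_ge0 ?exprn_ge0// sumr_ge0.
  have {}H : B / 2 ^+ n <= D `^ m^-1 * (((2 * x) `^ m^-1)^-1) ^+ n.
    have -> : B / 2 ^+ n = ((B / 2 ^+ n) `^ m) `^ m^-1.
      by rewrite -powRrM mulfV ?powRr1.
    have x2 : 0 < 2 * x by rewrite mulr_gt0.
    apply: (le_trans (ge0_ler_powR _ _ _ H)); rewrite ?nnegrE ?powR_ge0//.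
    - by rewrite invr_ge0 ltW.
    - by rewrite divr_ge0// exprn_ge0// ltW.
    rewrite [leLHS]powRM ?invr_ge0 ?exprn_ge0 ?(ltW x2)//.
    by rewrite -(exprVn (2 * x) n) powRX ?invr_ge0 ?(ltW x2)// powR_inv ?(ltW x2).
  rewrite -mulr_sumr -/B.
  have -> : c ^+ n * B = (c * 2) ^+ n * (B / 2 ^+ n).
    by rewrite exprMn mulrACA mulrA -mulrA divff ?mulr1 ?expf_neq0.
  apply: le_trans (ler_wpM2l _ H) _; first by rewrite exprn_ge0// mulr_ge0// ltW.
  by rewrite mulrCA -exprMn.
have S0 n : (0 <= (\sum_(k < 2 ^ n) c ^+ n * b n k)%:E)%E by rewrite lee_fin.
have HE n : ((\sum_(k < 2 ^ n) c ^+ n * b n k)%:E <=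
    (D `^ m^-1 * kap ^+ n)%:E)%E by rewrite lee_fin.
have := nneseries_le_geometric kap0 kap1 (powR_ge0 _ _) S0 HE.
move/(le_poweR (ltW m0)) => /(_ (nneseries_ge0 (fun n _ _ => S0 n))) {}H.
apply: (le_trans H).
rewrite poweR_EFin -EFinM lee_fin powRM ?powR_ge0 ?invr_ge0 ?(ltW k1)//.
by rewrite -powRrM mulVf// powRr1// powR_inv ?(ltW k1)// powRN mulrC.
Qed.
End Tools.

(** * Slices of two-parameter functions *)

Section Modulus.
Context {R : realType}.
Local Notation leb := (@lebesgue_measure R).

Definition EFin2 (g : R -> R -> R) : R -> R -> \bar R := fun s t => (g s t)%:E.

Lemma continuous2_dist T (f : R -> R -> R) u v eps : continuous2 T f ->
  0 <= u -> u <= v -> v <= T -> 0 < eps ->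
  exists2 e : R, 0 < e & forall a b, 0 <= a -> a <= b -> b <= T ->
    `|u - a| < e -> `|v - b| < e -> `|f u v - f a b| < eps.
Proof.
move=> /subspace_continuousP fc u0 uv vT eps0.
have /fc/cvgrPdist_lt/(_ _ eps0) : simplex T (u, v) by [].
rewrite near_withinE => /nbhs_ballP[e /= e0 H].
exists e => // a b a0 ab bT ua vb.
by apply: (H (a, b)).
Qed.

Lemma measurable_slice T (g : R -> R -> R) a l b : continuous2 T g ->
  0 <= a -> 0 <= l -> b + a + l <= T ->
  measurable_fun `[0%R, b] (fun s => g (s + a) (s + a + l)).
Proof.
move=> gc a0 l0 balT; apply: subspace_continuous_measurable_fun => //.
apply/subspace_continuousP => x; rewrite /= in_itv/= => /andP[x0 xb].
have simp s : 0 <= s -> s <= b -> simplex T (s + a, s + a + l).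
  by move=> s0 sb; split; [|split] => /=; lra.
apply/cvgrPdist_lt => eps eps0; rewrite near_withinE.
have [s0 [s1 s2]] := simp _ x0 xb.
have [e e0 He] := continuous2_dist gc s0 s1 s2 eps0.
exists e => //= s xs; rewrite in_itv/= => /andP[ss0 sb].
have [t0 [t1 t2]] := simp _ ss0 sb.
have e1 : x + a - (s + a) = x - s by ring.
have e2 : x + a + l - (s + a + l) = x - s by ring.
by apply: He; rewrite ?e1 ?e2.
Qed.

Lemma Lnorm_restrictE (P b : R) (f : R -> \bar R) : 0 < P ->
  (forall x : R, 0 <= x <= b -> (0 <= f x)%E) ->
  ('N[leb]_P%:E[f \_ `[0%R, b]] = (\int[leb]_(x in `[0%R, b]) f x `^ P) `^ P^-1)%E.
Proof.
move=> P0 f0; rewrite unlock/=; congr (_ `^ _)%E; rewrite [RHS]integral_mkcond.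
apply: eq_integral => x _; rewrite /patch; case: ifPn => [/set_mem/=|_].
  by rewrite in_itv/= => xb; rewrite gee0_abs// f0.
by rewrite abse0 poweR0r// gt_eqF.
Qed.

Lemma ae_imply (A B : R -> Prop) : (forall x, A x -> B x) ->
  {ae leb, forall x, A x} -> {ae leb, forall x, B x}.
Proof.
move=> AB [N [mN N0 AN]]; exists N; split => // x /= nB; apply: AN => /= nA.
exact/nB/AB.
Qed.

Lemma lebesgue_measureT_gt0 : (0 < leb [set: R])%E.
Proof.
apply: (@lt_le_trans _ _ (leb `[0%R, 1%R])).
  by rewrite lebesgue_measure_itv/= lte01 -EFinB subr0 lte01.
by apply: le_measure; rewrite ?inE.
Qed.

Lemma Lnormy_patch_leP (D : set R) (f : R -> \bar R) (Y : \bar R) : (0 <= Y)%E ->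
  (forall x : R, D x -> (0 <= f x)%E) ->
  ('N[leb]_+oo[f \_ D] <= Y)%E <-> {ae leb, forall x : R, D x -> (f x <= Y)%E}.
Proof.
move=> Y0 f0; rewrite unlock/= lebesgue_measureT_gt0.
split=> [/ess_supP|] H; last (apply/ess_supP); apply: ae_imply H => x /=.
- by rewrite /patch => + xb; rewrite mem_set// gee0_abs// f0.
- rewrite /patch; case: ifPn => [/set_mem/= xb|_]; last by rewrite abse0.
  by rewrite gee0_abs ?f0//; exact.
Qed.

Lemma Lnormy_restrict_leP (b : R) (f : R -> \bar R) (Y : \bar R) : (0 <= Y)%E ->
  (forall x : R, 0 <= x <= b -> (0 <= f x)%E) ->
  ('N[leb]_+oo[f \_ `[0%R, b]] <= Y)%E <->
  {ae leb, forall x : R, 0 <= x <= b -> (f x <= Y)%E}.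
Proof. exact: (@Lnormy_patch_leP `[0, b]%classic f Y). Qed.

(** By continuity a strict violation at one point persists on an interval of positive
    length. *)
Lemma ae_le_slice T (g : R -> R -> R) h Y : continuous2 T g -> 0 <= h -> h < T ->
  {ae leb, forall x : R, 0 <= x <= T - h -> ((g x (x + h)%R)%:E <= Y)%E} ->
  forall x, 0 <= x <= T - h -> ((g x (x + h)%R)%:E <= Y)%E.
Proof.
move=> gc h0 hT [A [mA A0 HA]] x /andP[x0 xT].
rewrite leNgt; apply/negP => Yg.
have [r Yr rg] : exists2 r : R, (Y <= r%:E)%E & r < g x (x + h).
  case: Y Yg {HA} => [Y| |]; first by rewrite lte_fin => ?; exists Y.
    by rewrite ltNge leey.
  by move=> _; exists (g x (x + h) - 1) => //; rewrite ?leNye//; lra.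
have xhT : x + h <= T by lra.
have xxh : x <= x + h by lra.
have [e e0 He] := continuous2_near gc x0 xxh xhT rg.
pose l := Num.max 0 (x - e / 2); pose u := Num.min (T - h) (x + e / 2).
have lu : l < u by rewrite gt_max !lt_min; apply/andP; split; apply/andP; split; lra.
have sub : `[l, u] `<=` A.
  move=> s; rewrite /= in_itv/= ge_max le_min => /andP[/andP[s0 sl] /andP[sT su]].
  apply: HA => /= H; have := H; rewrite s0 sT => /(_ isT).
  apply/negP; rewrite -ltNge (le_lt_trans Yr)// lte_fin.
  by apply: He; rewrite ?ltr_norml; lra.
have : (leb `[l, u]%classic <= leb A)%E by apply: le_measure; rewrite ?inE.
by rewrite A0 lebesgue_measure_itv/= lte_fin lu -EFinB lee_fin subr_le0 leNgt lu.
Qed.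

End Modulus.

(** * The integral modulus of the variation *)

Section ModulusBound.
Context {R : realType}.
Local Notation leb := (@lebesgue_measure R).

Lemma rho_variation_ge0 rho (f : R -> R -> \bar R) s t :
  (0 <= rho_variation rho f s t)%E.
Proof. exact: poweR_ge0. Qed.

Lemma dyadic_energy_le s h c rho (g : R -> R -> R) : 0 < c ->
  (dyadic_energy s h c rho g s (s + h) <=
   \sum_(n <oo) (\sum_(k < 2 ^ n)
      c ^+ n * g (dyad s h n k) (dyad s h n k.+1) `^ rho)%:E)%E.
Proof.
move=> c0; apply: lee_nneseries => n _.
  by rewrite lee_fin dyadic_term_ge0// ltW.
rewrite lee_fin /dyadic_term big_mkcond/=; apply: ler_sum => k _.
by case: ifP => // _; rewrite mulr_ge0 ?powR_ge0// exprn_ge0// ltW.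
Qed.

Lemma besov_modulus_ge_slice T p (g : R -> R -> \bar R) h t : 0 < h -> h <= t ->
  ('N[leb]_p[(fun s => g s (s + h)%R) \_ `[0%R, (T - h)%R]] <=
   besov_modulus T p g t)%E.
Proof.
move=> h0 ht; apply: ereal_sup_ubound; exists h => //=.
by rewrite in_itv/= h0.
Qed.

Section Bound.
Variables (z rho y : R).
Hypotheses (z0 : 0 < z) (z1 : z < 1) (rho0 : 0 < rho) (y0 : 0 < y).
Local Notation c := ((z ^+ 2) `^ rho)^-1.
(* Level n has 2^n terms of weight c^n, each of order y^(n rho). *)
Hypothesis cy : 2 * c * y `^ rho < 1.

Let c0 : 0 < c. Proof. by rewrite invr_gt0 powR_gt0// exprn_gt0. Qed.

(** What chaining uses of [f], of the function [w] that measures its defect, and of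
    the function [g] that dominates both [f] and [w ^+ 2]. *)
Definition chainable T (f w g : R -> R -> R) :=
  [/\ nonneg2 T w /\ nonneg2 T f,
      vanishes_on_diagonal T w /\ vanishes_on_diagonal T f,
      subadditive2 T w /\ quasi_subadditive T f w,
      continuous2 T f /\ continuous2 T g &
      forall s t, 0 <= s -> s <= t -> t <= T -> f s t <= g s t /\ w s t ^+ 2 <= g s t].

Lemma variation_le_series T (f w g : R -> R -> R) s h : chainable T f w g ->
  0 <= s -> 0 < h -> s + h <= T ->
  (rho_variation rho (EFin2 f) s (s + h) <=
    ((chain_const z `^ rho)%:E * \sum_(n <oo) (\sum_(k < 2 ^ n)
      c ^+ n * g (dyad s h n k) (dyad s h n k.+1) `^ rho)%:E) `^ rho^-1)%E.
Proof.
move=> [[w0 f0] [wd fd] [wS fS] [fc gc] fwg] s0 h0 shT.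
have fg a b (a0 : 0 <= a) (ab : a <= b) (bT : b <= T) : f a b <= g a b.
  by case: (fwg a b a0 ab bT).
have wg a b (a0 : 0 <= a) (ab : a <= b) (bT : b <= T) : w a b ^+ 2 <= g a b.
  by case: (fwg a b a0 ab bT).
apply: le_trans (variation_le_energy z0 z1 rho0 w0 f0 wd fd wS fS fc fg wg s0 h0 shT) _.
apply: le_poweR; first by rewrite invr_ge0 ltW.
  by rewrite mule_ge0 ?lee_fin ?powR_ge0// dyadic_energy_ge0// ltW.
by apply: lee_wpmul2l; [rewrite lee_fin powR_ge0|exact: dyadic_energy_le].
Qed.

Lemma chainable_ge0 T f w g s t : chainable T f w g ->
  0 <= s -> s <= t -> t <= T -> 0 <= g s t.
Proof.
move=> [[w0 f0] _ _ _ fwg] s0 st tT; apply: le_trans (f0 _ _ s0 st tT) _.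
by case: (fwg _ _ s0 st tT).
Qed.

Lemma dyad_in (T s h : R) n k : 0 <= s -> 0 < h -> s + h <= T -> (k < 2 ^ n)%N ->
  [/\ 0 <= dyad s h n k, dyad s h n k <= T - h / 2 ^+ n,
      dyad s h n k.+1 = dyad s h n k + h / 2 ^+ n &
      dyad s h n k.+1 <= T].
Proof.
move=> s0 h0 shT kn.
have kT : dyad s h n k.+1 <= T.
  by apply: le_trans shT; rewrite -(dyad_top s h n) dyad_le// ltW.
split=> //; [exact: le_trans (dyad_ge _ _ _ (ltW h0))| |exact: dyadS].
by rewrite lerBrDr -dyadS.
Qed.

Let h2_gt0 (h : R) n : 0 < h -> 0 < h / 2 ^+ n.
Proof. by move=> h0; rewrite divr_gt0// exprn_gt0. Qed.

Let h2_le (h t : R) n : h <= t -> h / 2 ^+ n <= t / 2 ^+ n.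
Proof. by move=> ht; rewrite ler_pM2r// invr_gt0 exprn_gt0. Qed.

(** Continuity turns the essential suprema of the dyadic increments into true bounds,
    so the energy is bounded pointwise by a geometric series. *)
Lemma modulus_bound_infty : exists2 C : R, 0 < C &
  forall T (f w g : R -> R -> R) t (Y : R), chainable T f w g ->
    0 < t -> t <= T -> 0 <= Y ->
    (forall n, besov_modulus T +oo (EFin2 g) (t / 2 ^+ n) <= (Y * y ^+ n)%:E)%E ->
    (besov_modulus T +oo (rho_variation rho (EFin2 f)) t <= (C * Y)%:E)%E.
Proof.
set k := 2 * c * y `^ rho; have k1 : 0 < 1 - k by rewrite subr_gt0.
have K0 := chain_const_gt0 z1.
exists (chain_const z * ((1 - k)^-1) `^ rho^-1).
  by rewrite mulr_gt0// powR_gt0// invr_gt0.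
move=> T f w g t Y fwg t0 tT Y0 gY.
apply: ge_ereal_sup => _ [h /= + <-]; rewrite in_itv/= => /andP[h0 ht].
have CY : 0 <= chain_const z * ((1 - k)^-1) `^ rho^-1 * Y.
  by rewrite mulr_ge0// mulr_ge0 ?powR_ge0// ltW.
apply/Lnormy_restrict_leP; rewrite ?lee_fin//.
  by move=> *; exact: rho_variation_ge0.
have [hT|Th] := ltP h T; last first.
  exists [set 0]; split; [by []|exact: lebesgue_measure_set1|].
  move=> x /= /not_implyP[/andP[x0 xT] _].
  by apply/eqP; rewrite eq_le x0 andbT; lra.
apply: aeW => x /andP[x0 xTh].
have xhT : x + h <= T by lra.
apply: le_trans (variation_le_series fwg x0 h0 xhT) _.
have gdy n (i : 'I_(2 ^ n)) :
    g (dyad x h n i) (dyad x h n i.+1) <= Y * y ^+ n.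
  have [d0 dT dS d1] := dyad_in x0 h0 xhT (ltn_ord i).
  rewrite dS -lee_fin; apply: (ae_le_slice (T := T)); last by rewrite d0 dT.
  - by case: fwg => _ _ _ [].
  - exact/ltW/h2_gt0.
  - apply: le_lt_trans hT; rewrite ler_pdivrMr ?exprn_gt0// ler_peMr ?(ltW h0)//.
    by rewrite exprn_ege1// ler1n.
  apply/Lnormy_restrict_leP.
  - by rewrite lee_fin mulr_ge0// exprn_ge0// ltW.
  - move=> s /andP[s0 sT]; rewrite lee_fin; apply: (chainable_ge0 fwg) => //.
      by rewrite lerDl ltW// h2_gt0.
    by rewrite -lerBrDr.
  - apply: le_trans (gY n); apply: (@besov_modulus_ge_slice _ _ (EFin2 g)).
      exact: h2_gt0.
    exact: h2_le.
have k0 : 0 <= k by rewrite !mulr_ge0 ?powR_ge0// ltW.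
have ser : (\sum_(n <oo) (\sum_(i < 2 ^ n)
      c ^+ n * g (dyad x h n i) (dyad x h n i.+1) `^ rho)%:E <=
      (Y `^ rho / (1 - k))%:E)%E.
  apply: nneseries_le_geometric => //; first exact: powR_ge0.
    move=> n; rewrite lee_fin sumr_ge0// => i _.
    by rewrite mulr_ge0 ?powR_ge0// exprn_ge0// ltW.
  move=> n; rewrite lee_fin.
  apply: (@le_trans _ _ (\sum_(i < 2 ^ n) c ^+ n * (Y * y ^+ n) `^ rho)).
    apply: ler_sum => i _; rewrite ler_wpM2l ?exprn_ge0 ?(ltW c0)//.
    have [d0 dT dS d1] := dyad_in x0 h0 xhT (ltn_ord i).
    apply: ge0_ler_powR; rewrite ?nnegrE ?(ltW rho0)//.
    - by apply: (chainable_ge0 fwg) => //; rewrite dS lerDl ltW// h2_gt0.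
    - by rewrite mulr_ge0// exprn_ge0// ltW.
  rewrite sumr_const card_ord -mulr_natl natrX powRM ?exprn_ge0 ?(ltW y0)//.
  rewrite (powRX rho n (ltW y0)).
  have -> : k ^+ n = 2 ^+ n * c ^+ n * (y `^ rho) ^+ n by rewrite -!exprMn.
  by rewrite [leRHS]mulrCA !mulrA lexx.
apply: le_trans (le_poweR _ _ (lee_wpmul2l _ ser)) _.
- by rewrite invr_ge0 ltW.
- rewrite mule_ge0 ?lee_fin ?powR_ge0//; apply: nneseries_ge0 => n _ _.
  rewrite lee_fin sumr_ge0// => i _.
  by rewrite mulr_ge0 ?powR_ge0// exprn_ge0// ltW.
- by rewrite lee_fin powR_ge0.
rewrite -EFinM poweR_EFin lee_fin powRM ?powR_ge0//; last first.
  by rewrite divr_ge0 ?powR_ge0// ltW.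
rewrite powRM ?powR_ge0 ?invr_ge0 ?(ltW k1)// -!powRrM mulfV ?gt_eqF//.
by rewrite !powRr1// ?(ltW K0)// -mulrA [Y * _]mulrC.
Qed.

(** The weight x is chosen with (2c)^m < 2x < y^-P, where m = P/rho.  The left
    inequality makes [nneseries_dyadic_powR] applicable, so that the P-th power of
    the variation is at most a sum of P-th powers, which can be integrated term by
    term; the right one makes the integrated series converge.  The interval for x
    is not empty since 2 c y^rho < 1. *)
Lemma modulus_bound_fin P : rho <= P -> exists2 C : R, 0 < C &
  forall T (f w g : R -> R -> R) t (Y : R), chainable T f w g ->
    0 < t -> t <= T -> 0 <= Y ->
    (forall n, besov_modulus T P%:E (EFin2 g) (t / 2 ^+ n) <= (Y * y ^+ n)%:E)%E ->
    (besov_modulus T P%:E (rho_variation rho (EFin2 f)) t <= (C * Y)%:E)%E.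
Proof.
move=> rhoP; have P0 : 0 < P by exact: lt_le_trans rhoP.
pose m := P / rho; have m1 : 1 <= m by rewrite /m ler_pdivlMr// mul1r.
have m0 : 0 < m by exact: lt_le_trans m1.
have rm : rho * m = P by rewrite /m mulrC divfK// gt_eqF.
have c2 : 0 < 2 * c by rewrite mulr_gt0.
have yP : 0 < y `^ P by exact: powR_gt0.
have gap : (2 * c) `^ m < (y `^ P)^-1.
  rewrite -[ltRHS]mul1r ltr_pdivlMr// -rm powRrM -powRM ?powR_ge0 ?(ltW c2)//.
  have p11 : 1 `^ m = 1 :> R by rewrite powR1.
  rewrite -[ltRHS]p11; apply: gt0_ltr_powR; rewrite ?nnegrE//.
  by rewrite mulr_ge0 ?powR_ge0// ltW.
(* Twice x is the midpoint of the admissible interval. *)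
pose x := ((2 * c) `^ m + (y `^ P)^-1) / 4.
have cm0 : 0 < (2 * c) `^ m by exact: powR_gt0.
have x0 : 0 < x by rewrite divr_gt0// addr_gt0// invr_gt0.
have x2 : 2 * x = ((2 * c) `^ m + (y `^ P)^-1) / 2 by rewrite /x; field; rewrite gt_eqF.
have xl : (2 * c) `^ m < 2 * x by rewrite x2; lra.
have xu : 2 * x < (y `^ P)^-1 by rewrite x2; lra.
pose kap := c * 2 * ((2 * x) `^ m^-1)^-1.
have kap1 : kap < 1.
  rewrite /kap ltr_pdivrMr ?mul1r; last by rewrite powR_gt0// mulr_gt0.
  have e : 2 * c = ((2 * c) `^ m) `^ m^-1.
    by rewrite -powRrM mulfV ?lt0r_neq0// powRr1// ltW.
  rewrite mulrC [ltLHS]e; apply: gt0_ltr_powR; rewrite ?nnegrE ?invr_gt0 ?powR_ge0//.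
  by rewrite mulr_ge0// ltW.
pose k := 2 * x * y `^ P.
have k0 : 0 <= k by rewrite mulr_ge0 ?powR_ge0// mulr_ge0// ltW.
have k1 : k < 1 by rewrite /k -ltr_pdivlMr// mul1r.
have K0 := chain_const_gt0 z1.
pose A := chain_const z `^ P * (1 - kap) `^ (- m).
have A0 : 0 < A by rewrite mulr_gt0// powR_gt0// subr_gt0.
have A1 : 0 < A / (1 - k) by rewrite divr_gt0// subr_gt0.
exists ((A / (1 - k)) `^ P^-1); first exact: powR_gt0.
move=> T f w g t Y fwg t0 tT Y0 gY.
apply: ge_ereal_sup => _ [h /= + <-]; rewrite in_itv/= => /andP[h0 ht].
rewrite Lnorm_restrictE//; last by move=> *; exact: rho_variation_ge0.
have Yn n : 0 <= Y * y ^+ n by rewrite mulr_ge0// exprn_ge0// ltW.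
(* A dyadic increment of level n is a translate in s of the slice of step h/2^n,
   and the translate stays inside the domain of that slice. *)
have slice n (i : 'I_(2 ^ n)) :
    (\int[leb]_(s in `[0%R, (T - h)%R])
       ((g (dyad s h n i) (dyad s h n i.+1)) `^ P)%:E <=
     ((Y * y ^+ n) `^ P)%:E)%E.
  pose a := h * i%:R / 2 ^+ n; pose l := h / 2 ^+ n.
  have a0 : 0 <= a by rewrite divr_ge0 ?exprn_ge0// mulr_ge0// ltW.
  have l0 : 0 < l by exact: h2_gt0.
  have al : a + l <= h.
    have := dyad_in (lexx 0) h0 (lexx (0 + h)) (ltn_ord i).
    by rewrite /dyad !add0r -/a -/l => -[_ + _ _]; rewrite lerBrDr.
  have gl0 s : 0 <= s <= T - l -> 0 <= g s (s + l).
    move=> /andP[s0 sT]; apply: (chainable_ge0 fwg) => //.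
      by rewrite lerDl ltW.
    by rewrite -lerBrDr.
  have mg : measurable_fun `[0%R, (T - l)%R] (fun s => ((g s (s + l)) `^ P)%:E).
    apply/measurable_EFinP; apply: (measurableT_comp (measurable_powR P)).
    have gc : continuous2 T g by case: fwg => _ _ _ [].
    have e : (fun s => g s (s + l)) = (fun s => g (s + 0) (s + 0 + l)).
      by apply/funext => s; rewrite addr0.
    rewrite e; apply: (measurable_slice gc (lexx 0) (ltW l0)).
    by rewrite addr0 subrK.
  have bnd : (\int[leb]_(s in `[0%R, (T - l)%R]) ((g s (s + l)) `^ P)%:E <=
      ((Y * y ^+ n) `^ P)%:E)%E.
    have := gY n; move/(le_trans (@besov_modulus_ge_slice T P%:E (EFin2 g) _ _ l0 (h2_le n ht))).
    rewrite Lnorm_restrictE//.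
    move=> /(le_poweR (ltW P0) (poweR_ge0 _ _)).
    rewrite -poweRrM mulVf ?gt_eqF// poweRe1//.
    by apply: integral_ge0 => s _; exact: poweR_ge0.
  apply: le_trans bnd.
  have pos s : `[0%R, (T - l)%R]%classic s -> (0 <= ((g s (s + l)) `^ P)%:E)%E.
    by rewrite lee_fin powR_ge0.
  rewrite -(integral_affine a ltr01 _ mg pos)// mul1e; apply: (@le_trans _ _ (\int[leb]_(s in `[0%R, (T - h)%R])
      ((g (a + 1 * s) (a + 1 * s + l)) `^ P)%:E)%E).
    rewrite le_eqVlt; apply/orP; left; apply/eqP; apply: eq_integral => s _.
    by rewrite dyadS /dyad mul1r [a + s]addrC.
  have mpre : measurable ((fun s => a + 1 * s) @^-1` `[0%R, (T - l)%R]).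
    by rewrite -[X in measurable X]setTI; exact: measurable_affine.
  apply: ge0_subset_integral => //.
  - apply: (measurable_comp (F := `[0%R, (T - l)%R]) _ _ mg) => //.
      by move=> _ [s /= sD <-].
    exact: measurable_funTS (measurable_affine a 1).
  - by move=> s _; rewrite lee_fin powR_ge0.
  - move=> s; rewrite /= !in_itv/= mul1r => /andP[s0 sT].
    by rewrite addr_ge0//=; lra.
have t0' n (i : 'I_(2 ^ n)) s :
    0 <= x ^+ n * g (dyad s h n i) (dyad s h n i.+1) `^ P.
  by rewrite mulr_ge0 ?powR_ge0// exprn_ge0// ltW.
have sum_ge0 n s : (0 <= (\sum_(i < 2 ^ n)
    x ^+ n * g (dyad s h n i) (dyad s h n i.+1) `^ P)%:E)%E.
  by rewrite lee_fin sumr_ge0.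
have ptw s : 0 <= s <= T - h -> (rho_variation rho (EFin2 f) s (s + h) `^ P <=
    A%:E * \sum_(n <oo) (\sum_(i < 2 ^ n)
      x ^+ n * g (dyad s h n i) (dyad s h n i.+1) `^ P)%:E)%E.
  move=> /andP[s0 sT]; have shT : s + h <= T by rewrite -lerBrDr.
  have := variation_le_series fwg s0 h0 shT.
  move/(le_poweR (ltW P0) (rho_variation_ge0 _ _ _ _)) => /le_trans; apply.
  rewrite -poweRrM [rho^-1 * P]mulrC -/m.
  have ser0 : (0 <= \sum_(n <oo) (\sum_(k0 < 2 ^ n)
      c ^+ n * g (dyad s h n k0) (dyad s h n k0.+1) `^ rho)%:E)%E.
    apply: nneseries_ge0 => n _ _; rewrite lee_fin sumr_ge0// => i _.
    by rewrite mulr_ge0 ?powR_ge0// exprn_ge0// ltW.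
  rewrite poweRM ?lee_fin ?powR_ge0// poweR_EFin -powRrM rm /A EFinM -muleA.
  apply: lee_wpmul2l; first by rewrite lee_fin powR_ge0.
  have b0 n (i : nat) : 0 <= g (dyad s h n i) (dyad s h n i.+1) `^ rho by exact: powR_ge0.
  apply: (le_trans (nneseries_dyadic_powR c0 x0 m1 b0 kap1)).
  apply: lee_wpmul2l; first by rewrite lee_fin powR_ge0.
  apply: lee_nneseries => n _; first by rewrite lee_fin sumr_ge0// => i _;
    rewrite mulr_ge0 ?powR_ge0// exprn_ge0// ltW.
  by rewrite lee_fin; apply: ler_sum => i _; rewrite -powRrM rm.
have mterm n (i : 'I_(2 ^ n)) : measurable_fun `[0%R, (T - h)%R]
    (fun s => (g (dyad s h n i) (dyad s h n i.+1) `^ P)%:E).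
  pose a := h * i%:R / 2 ^+ n; pose l := h / 2 ^+ n.
  have a0 : 0 <= a by rewrite divr_ge0 ?exprn_ge0// mulr_ge0// ltW.
  have l0 : 0 < l by exact: h2_gt0.
  have al : a + l <= h.
    have := dyad_in (lexx 0) h0 (lexx (0 + h)) (ltn_ord i).
    by rewrite /dyad !add0r -/a -/l => -[_ + _ _]; rewrite lerBrDr.
  apply/measurable_EFinP; apply: (measurableT_comp (measurable_powR P)).
  have gc : continuous2 T g by case: fwg => _ _ _ [].
  have alT : T - h + a + l <= T by lra.
  have e : (fun s => g (dyad s h n i) (dyad s h n i.+1)) =
      (fun s => g (s + a) (s + a + l)) by apply/funext => s; rewrite dyadS.
  by rewrite e; exact: (measurable_slice gc a0 (ltW l0) alT).
have msum n : measurable_fun `[0%R, (T - h)%R] (fun s => (\sum_(i < 2 ^ n)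
    x ^+ n * g (dyad s h n i) (dyad s h n i.+1) `^ P)%:E).
  have -> : (fun s => (\sum_(i < 2 ^ n)
      x ^+ n * g (dyad s h n i) (dyad s h n i.+1) `^ P)%:E) =
    (fun s => \sum_(i < 2 ^ n)
      ((x ^+ n)%:E * (g (dyad s h n i) (dyad s h n i.+1) `^ P)%:E))%E.
    by apply/funext => s; rewrite -sumEFin; apply: eq_bigr => i _; rewrite EFinM.
  by apply: emeasurable_sum => i; exact: measurable_funeM.
have {}ptw : (\int[leb]_(s in `[0%R, (T - h)%R])
    rho_variation rho (EFin2 f) s (s + h) `^ P <= (A / (1 - k) * Y `^ P)%:E)%E.
  apply: (@le_trans _ _ (\int[leb]_(s in `[0%R, (T - h)%R])
    (A%:E * \sum_(n <oo) (\sum_(i < 2 ^ n)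
      x ^+ n * g (dyad s h n i) (dyad s h n i.+1) `^ P)%:E))%E).
    apply: ge0_le_lower_integral => s; first by move=> _; exact: poweR_ge0.
    by rewrite /= in_itv/=; exact: ptw.
  rewrite ge0_integralZl_EFin ?(ltW A0)//; last 2 first.
  - by move=> s _; exact: nneseries_ge0.
  - by apply: ge0_emeasurable_sum => // n _; exact: msum.
  have -> : A / (1 - k) * Y `^ P = A * (Y `^ P / (1 - k)) by rewrite mulrAC mulrA.
  rewrite integral_nneseries// [leRHS]EFinM.
  apply: lee_wpmul2l; first by rewrite lee_fin ltW.
  apply: nneseries_le_geometric => //; first exact: powR_ge0.
    by move=> n; apply: integral_ge0 => s _.
  move=> n.
  have -> : (\int[leb]_(s in `[0%R, (T - h)%R]) (\sum_(i < 2 ^ n)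
      x ^+ n * g (dyad s h n i) (dyad s h n i.+1) `^ P)%:E =
    \int[leb]_(s in `[0%R, (T - h)%R]) \sum_(i < 2 ^ n)
      ((x ^+ n)%:E * (g (dyad s h n i) (dyad s h n i.+1) `^ P)%:E))%E.
    apply: eq_integral => s _; rewrite -sumEFin.
    by apply: eq_bigr => i _; rewrite EFinM.
  have mF (i : 'I_(2 ^ n)) : measurable_fun `[0%R, (T - h)%R]
      (fun s => (x ^+ n)%:E * (g (dyad s h n i) (dyad s h n i.+1) `^ P)%:E)%E.
    exact: measurable_funeM.
  rewrite ge0_integral_sum//; last first.
    by move=> i s _; rewrite -EFinM lee_fin.
  apply: (@le_trans _ _ (\sum_(i < 2 ^ n) (x ^+ n * (Y * y ^+ n) `^ P)%:E)%E).
    apply: lee_sum => i _; rewrite ge0_integralZl_EFin ?exprn_ge0 ?(ltW x0)//.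
    - by rewrite EFinM; apply: lee_wpmul2l => //; rewrite lee_fin exprn_ge0// ltW.
    - by move=> s _; rewrite lee_fin powR_ge0.
    - exact: mterm.
  rewrite sumEFin lee_fin sumr_const card_ord -mulr_natl natrX.
  rewrite powRM ?exprn_ge0 ?(ltW y0)// (powRX P n (ltW y0)).
  have -> : k ^+ n = 2 ^+ n * x ^+ n * (y `^ P) ^+ n by rewrite -!exprMn.
  by rewrite [leRHS]mulrCA !mulrA lexx.
apply: (le_trans (le_poweR _ _ ptw)); first by rewrite invr_ge0 ltW.
  by apply: integral_ge0 => s _; exact: poweR_ge0.
rewrite poweR_EFin lee_fin powRM ?powR_ge0 ?(ltW A1)//.
by rewrite -powRrM mulfV ?gt_eqF// powRr1.
Qed.

Lemma modulus_bound p : (rho%:E <= p)%E -> exists2 C : R, 0 < C &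
  forall T (f w g : R -> R -> R) t (Y : \bar R), chainable T f w g ->
    0 < t -> t <= T -> (0 <= Y)%E ->
    (forall n, besov_modulus T p (EFin2 g) (t / 2 ^+ n) <= Y * (y ^+ n)%:E)%E ->
    (besov_modulus T p (rho_variation rho (EFin2 f)) t <= C%:E * Y)%E.
Proof.
case: p => [P| |]//.
- rewrite lee_fin => /modulus_bound_fin[C C0 H]; exists C => // T f w g t Y ch t0 tT.
  case: Y => [Y| |]//; first by rewrite lee_fin => Y0 gY; apply: H ch t0 tT Y0 gY.
  by move=> _ _; rewrite gt0_muley ?leey// lte_fin.
- move=> _; have [C C0 H] := modulus_bound_infty; exists C => // T f w g t Y ch t0 tT.
  case: Y => [Y| |]//; first by rewrite lee_fin => Y0 gY; apply: H ch t0 tT Y0 gY.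
  by move=> _ _; rewrite gt0_muley ?leey// lte_fin.
Qed.

End Bound.
End ModulusBound.

(** * The weight in t: a Hardy inequality *)

Section Outer.
Context {R : realType}.
Local Notation leb := (@lebesgue_measure R).

(** The outer norm of [besov_norm], as a functional of an arbitrary modulus; the
    properties of Besov norms are proved separately in s and in t. *)
Definition besov_weight (T a : R) (q : \bar R) (Om : R -> \bar R) : \bar R :=
  let f t := (Om t / (t `^ a)%:E)%E in
  match q with
  | q%:E => ((\int[leb]_(t in `]0%R, T]) (f t `^ q / t%:E)) `^ q^-1)%E
  | +oo%E => 'N[leb]_+oo[f \_ `]0%R, T]]%E
  | -oo%E => 0%E
  end.

Lemma besov_normE T a p q chi :
  besov_norm T a p q chi = besov_weight T a q (besov_modulus T p chi).
Proof. by []. Qed.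

Definition monotone_modulus (Om : R -> \bar R) :=
  (forall s t, s <= t -> (Om s <= Om t)%E) /\ (forall t, 0 < t -> (0 <= Om t)%E).

(** Preimages of rays under a nondecreasing function are intervals. *)
Lemma emonotone_measurable (Om : R -> \bar R) (D : set R) : measurable D ->
  (forall s t, s <= t -> (Om s <= Om t)%E) -> measurable_fun D Om.
Proof.
move=> mD mon; apply: measurable_funTS.
apply: (measurability _ (ErealGenOInfty.measurableE R)) => /= _ [_ [r ->] <-].
rewrite setTI; apply: is_interval_measurable => s t /=.
rewrite !in_itv/= !andbT => rs rt u /andP[su ut].
by rewrite in_itv/= andbT (lt_le_trans rs)// mon.
Qed.

Lemma besov_modulus_mon T p chi :
  monotone_modulus (besov_modulus T p chi).
Proof.
split=> [s t st|t t0].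
  rewrite /besov_modulus; apply: ereal_sup_le => _ [h /= + <-].
  rewrite in_itv/= => /andP[h0 hs].
  by exists h => //=; rewrite in_itv/= h0 (le_trans hs).
apply: le_trans (besov_modulus_ge_slice T p chi t0 (lexx t)).
exact: Lnorm_ge0.
Qed.

Lemma exists_ae_between (P : R -> Prop) T l u : {ae leb, forall t, 0 < t <= T -> P t} ->
  0 <= l -> l < u -> u <= T -> exists t, [/\ l < t, t <= u & P t].
Proof.
move=> [A [mA A0 HA]] l0 lu uT; apply: contrapT => nex.
have sub : `]l, u] `<=` A.
  move=> t /=; rewrite in_itv/= => /andP[lt tu]; apply: HA => /= H; apply: nex.
  by exists t; split => //; apply: H; rewrite (le_lt_trans l0 lt) (le_trans tu uT).
have : (leb `]l, u]%classic <= leb A)%E by apply: le_measure; rewrite ?inE.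
by rewrite A0 lebesgue_measure_itv/= lte_fin lu -EFinB lee_fin subr_le0 leNgt lu.
Qed.

Lemma lee_pdivr_EFin (x y : \bar R) (t : R) : 0 < t ->
  (x / t%:E <= y)%E = (x <= y * t%:E)%E.
Proof. by move=> t0; rewrite inver gt_eqF// lee_pdivrMr. Qed.

Lemma weight_ge0 (a : R) (Om : R -> \bar R) t : 0 < t -> (0 <= Om t)%E ->
  (0 <= Om t / (t `^ a)%:E)%E.
Proof. by move=> t0 O0; rewrite mule_ge0// inver gt_eqF ?powR_gt0// lee_fin invr_ge0 powR_ge0. Qed.

Lemma poweRK (q : R) (x : \bar R) : 0 < q -> (0 <= x)%E ->
  ((x `^ q) `^ q^-1 = x)%E.
Proof. by move=> q0 x0; rewrite -poweRrM mulfV ?poweRe1// gt_eqF. Qed.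

Lemma besov_weight_ge0 T a q Om : (0 <= besov_weight T a q Om)%E.
Proof. by case: q => [q| |] //=; [exact: poweR_ge0|exact: Lnorm_ge0]. Qed.

Lemma weight_integrandE (a q : R) (x : \bar R) t : 0 < t -> (0 <= x)%E ->
  ((x / (t `^ a)%:E) `^ q / t%:E = x `^ q * (t `^ (- (a * q) - 1))%:E)%E.
Proof.
move=> t0 x0; rewrite !inver !gt_eqF ?powR_gt0//.
rewrite poweRM ?lee_fin ?invr_ge0 ?powR_ge0// -muleA; congr (_ * _)%E.
rewrite poweR_EFin -EFinM -powRN -powRrM mulNr -powR_inv1 ?(ltW t0)// -powRD//.
by apply/implyP => _; rewrite gt_eqF.
Qed.

Lemma besov_weight_finE T a (q : R) (Om : R -> \bar R) :
  (forall t, 0 < t -> t <= T -> (0 <= Om t)%E) ->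
  besov_weight T a q%:E Om =
  ((\int[leb]_(t in `]0%R, T]) (Om t `^ q * (t `^ (- (a * q) - 1))%:E)) `^ q^-1)%E.
Proof.
move=> O0; rewrite /besov_weight; congr (_ `^ _)%E; apply: eq_integral => t.
rewrite inE/= in_itv/= => /andP[t0 tT]; exact: weight_integrandE (O0 _ t0 tT).
Qed.

Lemma measurable_weight (T e q : R) (Om : R -> \bar R) : monotone_modulus Om ->
  measurable_fun `]0%R, T] (fun t => Om t `^ q * (t `^ e)%:E)%E.
Proof.
move=> [mon _]; apply: emeasurable_funM.
  apply: (measurableT_comp (measurable_poweR q)); exact: emonotone_measurable.
apply/measurable_EFinP; exact: measurable_funTS (measurable_powR e).
Qed.

(** The change of variables t -> k t maps ]0, T] into itself because k <= 1. *)
Lemma integral_weight_scale (T e q k : R) (Om : R -> \bar R) :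
  monotone_modulus Om -> 0 < k -> k <= 1 ->
  (\int[leb]_(t in `]0%R, T]) (Om (k * t)%R `^ q * (t `^ e)%:E) <=
   (k `^ (- e - 1))%:E * \int[leb]_(t in `]0%R, T]) (Om t `^ q * (t `^ e)%:E))%E.
Proof.
move=> Omon k0 k1.
pose F t := (Om t `^ q * (t `^ e)%:E)%E.
have F0 t : (0 <= F t)%E by rewrite mule_ge0 ?poweR_ge0// lee_fin powR_ge0.
have mF (b : R) : measurable_fun `]0%R, b] F by exact: measurable_weight.
have mFk : measurable_fun `]0%R, T] (F \o *%R k).
  apply: (measurable_comp (F := `]0%R, (k * T)%R]) _ _ (mF _)) => //.
    move=> _ [t /= + <-]; rewrite !in_itv/= => /andP[t0 tT].
    by rewrite mulr_gt0//= ler_pM2l.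
have -> : (\int[leb]_(t in `]0%R, T]) (Om (k * t)%R `^ q * (t `^ e)%:E) =
    \int[leb]_(t in `]0%R, T]) ((k `^ (- e))%:E * (F \o *%R k) t))%E.
  apply: eq_integral => t; rewrite inE/= in_itv/= => /andP[t0 tT].
  rewrite /F muleCA -EFinM powRM ?(ltW t0) ?(ltW k0)// mulrA -powRD.
    by rewrite addNr powRr0 mul1r.
  by apply/implyP => _; rewrite gt_eqF.
change (\int[leb]_(t in `]0%R, T]) (Om t `^ q * (t `^ e)%:E))%E with
  (\int[leb]_(t in `]0%R, T]) F t)%E.
clearbody F; rewrite (ge0_integralZl_EFin leb (measurable_itv _) _ mFk) ?powR_ge0//; last first.
  by move=> t _; exact: F0.
have pre : (fun s => 0 + k * s) @^-1` `]0%R, (k * T)%R] = `]0%R, T]%classic.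
  rewrite affine_preimage_itvoc// subr0 mul0r subr0 mulrC mulKf//.
  by rewrite gt_eqF.
have E : (k%:E * \int[leb]_(s in `]0%R, T]) (F \o *%R k) s =
    \int[leb]_(t in `]0%R, (k * T)%R]) F t)%E.
  have F0' x : `]0%R, (k * T)%R]%classic x -> (0 <= F x)%E by move=> _; exact: F0.
  rewrite -(integral_affine 0 k0 (measurable_itv _) (mF _) F0') pre.
  by congr (_ * _)%E; apply: eq_integral => t _; rewrite add0r.
have -> : k `^ (- e) = k `^ (- e - 1) * k.
  rewrite -{3}(powRr1 (ltW k0)) -powRD ?subrK//.
  by apply/implyP => _; rewrite gt_eqF.
rewrite EFinM -muleA E; apply: lee_wpmul2l; first by rewrite lee_fin powR_ge0.
have [T0|T0] := leP 0 T.
  apply: ge0_subset_integral => //; first exact: mF.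
  move=> t; rewrite /= !in_itv/= => /andP[-> tk]; rewrite (le_trans tk)//.
  by rewrite ler_piMl.
rewrite !set_itv_ge ?integral_set0// bnd_simp -leNgt ?ltW//.
by rewrite pmulr_rlt0.
Qed.

(** Apply the hypothesis at t with Y the l^q norm of the sequence
    y^-n Om2(t/2^n).  After integration, scaling bounds the n-th term by eta^n times
    the first, where eta < 1 because 2^-a < y. *)
Lemma besov_weight_hardy_fin (T a q y C0 : R) : 0 < q -> 0 < y -> 0 < C0 ->
  2 `^ (- a) < y ->
  exists2 C : R, 0 < C & forall Om1 Om2 : R -> \bar R,
    monotone_modulus Om2 -> (forall t, 0 < t -> (0 <= Om1 t)%E) ->
    (forall (t : R) (Y : \bar R), 0 < t -> t <= T -> (0 <= Y)%E ->
       (forall n, (Om2 (t / 2 ^+ n)%R <= Y * (y ^+ n)%:E)%E) -> (Om1 t <= C0%:E * Y)%E) ->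
    (besov_weight T a q%:E Om1 <= C%:E * besov_weight T a q%:E Om2)%E.
Proof.
move=> q0 y0 C00 ay.
pose eta := (y^-1 * 2 `^ (- a)) `^ q.
have b0 : 0 < y^-1 * 2 `^ (- a) by rewrite mulr_gt0 ?invr_gt0 ?powR_gt0.
have eta1 : eta < 1.
  have p11 : 1 `^ q = 1 :> R by rewrite powR1.
  rewrite -[ltRHS]p11; apply: gt0_ltr_powR; rewrite ?nnegrE ?(ltW b0)//.
  by rewrite mulrC ltr_pdivrMr// mul1r.
have eta0 : 0 <= eta by exact: powR_ge0.
exists (C0 * (1 - eta) `^ (- q^-1)).
  by rewrite mulr_gt0// powR_gt0// subr_gt0.
move=> Om1 Om2 [mon pos] O1 H.
rewrite !besov_weight_finE//; last 2 first.
- by move=> t t0 _; exact: pos.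
- by move=> t t0 _; exact: O1.
have eE : - (- (a * q) - 1) - 1 = a * q by ring.
move: (- (a * q) - 1) eE => e eE.
set B := (\int[leb]_(t in _) (Om2 t `^ q * _))%E.
have B0 : (0 <= B)%E.
  by apply: integral_ge0 => t _; rewrite mule_ge0 ?poweR_ge0// lee_fin powR_ge0.
pose G n (t : R) := (((y ^- n) `^ q)%:E * (Om2 (2 ^- n * t)%R `^ q * (t `^ e)%:E))%E.
have G0 n t : (0 <= G n t)%E.
  by rewrite !mule_ge0 ?lee_fin ?powR_ge0 ?poweR_ge0.
have ptw t : 0 < t -> t <= T ->
    (Om1 t `^ q * (t `^ e)%:E <= (C0 `^ q)%:E * \sum_(n <oo) G n t)%E.
  move=> t0 tT; pose S := (\sum_(n <oo) ((y ^- n)%:E * Om2 (t / 2 ^+ n)%R) `^ q)%E.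
  have S0 : (0 <= S)%E by apply: nneseries_ge0 => n _ _; exact: poweR_ge0.
  have OY : (Om1 t <= C0%:E * S `^ q^-1)%E.
    apply: H => //; first exact: poweR_ge0.
    move=> n; rewrite -lee_pdivr_EFin ?exprn_gt0// inver gt_eqF ?exprn_gt0// muleC.
    have z0 : (0 <= (y ^- n)%:E * Om2 (t / 2 ^+ n)%R)%E.
      rewrite mule_ge0 ?lee_fin ?invr_ge0 ?exprn_ge0 ?(ltW y0)// pos//.
      by rewrite divr_gt0// exprn_gt0.
    rewrite -[leLHS](poweRK q0 z0).
    apply: le_poweR; [by rewrite invr_ge0 ltW|exact: poweR_ge0|].
    rewrite /S (nneseriesD1 (n := n))//=; last by move=> *; exact: poweR_ge0.
    by rewrite leeDl// nneseries_ge0// => *; exact: poweR_ge0.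
  have -> : (\sum_(n <oo) G n t = S * (t `^ e)%:E)%E.
    rewrite [RHS]muleC /S -[RHS]nneseriesZl; last by move=> *; exact: poweR_ge0.
    apply: eq_eseriesr => n _; rewrite /G poweRM ?lee_fin ?invr_ge0 ?exprn_ge0 ?(ltW y0)//.
      by rewrite [t / _]mulrC muleA [LHS]muleC.
    by rewrite pos// divr_gt0// exprn_gt0.
  rewrite muleA; apply: lee_wpmul2r; first by rewrite lee_fin powR_ge0.
  apply: (le_trans (le_poweR (ltW q0) (O1 _ t0) OY)).
  by rewrite poweRM ?poweR_ge0 ?lee_fin ?(ltW C00)// -poweRrM mulVf ?gt_eqF// poweRe1.
have k0 n : 0 < 2 ^- n :> R by rewrite invr_gt0 exprn_gt0.
have k1 n : 2 ^- n <= 1 :> R by rewrite invf_le1 ?exprn_gt0// exprn_ege1// ler1n.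
have mG n : measurable_fun `]0%R, T] (G n).
  apply: measurable_funeM; apply: (@measurable_weight T e q (fun t => Om2 (2 ^- n * t))).
  split=> [s t st|t t0]; first by rewrite mon// ler_pM2l.
  by rewrite pos// mulr_gt0.
have IG n : (\int[leb]_(t in `]0%R, T]) G n t <= B * (eta ^+ n)%:E)%E.
  have mon' : monotone_modulus (fun t => Om2 (2 ^- n * t)).
    split=> [s t st|t t0]; first by rewrite mon// ler_pM2l.
    by rewrite pos// mulr_gt0.
  rewrite ge0_integralZl_EFin ?powR_ge0//; last 2 first.
  - by move=> t _; rewrite mule_ge0 ?poweR_ge0// lee_fin powR_ge0.
  - exact: measurable_weight mon'.
  apply: le_trans (lee_wpmul2l _ (integral_weight_scale T e q (conj mon pos) (k0 n) (k1 n))) _.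
    by rewrite lee_fin powR_ge0.
  rewrite muleA -EFinM [(B * _)%E]muleC; apply: lee_wpmul2r => //.
  rewrite lee_fin /eta -powRX ?(ltW b0)// exprMn powRM ?exprn_ge0 ?invr_ge0 ?powR_ge0 ?(ltW y0)//.
  rewrite eE.
  have -> : (2 ^- n) `^ (a * q) = ((2 `^ (- a)) ^+ n) `^ q.
    rewrite powRrM; congr (_ `^ q).
    by rewrite powR_inv ?exprn_ge0// powRX// powRN exprVn.
  by rewrite exprVn.
have II : (\int[leb]_(t in `]0%R, T]) (Om1 t `^ q * (t `^ e)%:E) <=
    (C0 `^ q)%:E * \sum_(n <oo) \int[leb]_(t in `]0%R, T]) G n t)%E.
  rewrite -integral_nneseries//.
  rewrite -ge0_integralZl_EFin ?powR_ge0//; last 2 first.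
  - by move=> t _; apply: nneseries_ge0.
  - by apply: ge0_emeasurable_sum => // n _; exact: mG.
  apply: ge0_le_lower_integral => t; rewrite /= in_itv/= => /andP[t0 tT].
    by rewrite mule_ge0 ?poweR_ge0// lee_fin powR_ge0.
  exact: ptw.
have C1 : 0 < C0 * (1 - eta) `^ (- q^-1) by rewrite mulr_gt0// powR_gt0// subr_gt0.
case: B B0 IG => [B| |]// B0 IG; last first.
  by rewrite poweRyr ?invr_eq0 ?gt_eqF// gt0_muley ?leey.
rewrite lee_fin in B0.
have ser : (\sum_(n <oo) \int[leb]_(t in `]0%R, T]) G n t <= (B / (1 - eta))%:E)%E.
  apply: nneseries_le_geometric => // n.
  by apply: integral_ge0 => t _.
have {}II := le_trans II (lee_wpmul2l _ ser).
have q1 : 0 <= q^-1 by rewrite invr_ge0 ltW.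
apply: le_trans (le_poweR q1 _ (II _)) _; rewrite ?lee_fin ?powR_ge0//.
  by apply: integral_ge0 => t _; rewrite mule_ge0 ?poweR_ge0// lee_fin powR_ge0.
have e1 : 0 <= (1 - eta)^-1 by rewrite invr_ge0 subr_ge0 ltW.
rewrite powRM ?powR_ge0// ?mulr_ge0// -powRrM mulfV ?gt_eqF//.
rewrite powRr1 ?(ltW C00)// powRM// powR_inv ?subr_ge0 ?(ltW eta1)// -powRN.
by rewrite [B `^ _ * _]mulrC mulrA.
Qed.

(** The essential supremum sees almost every point only; monotonicity passes the bound
    from some point of ]t, 2t] to t, which costs the factor 2^a. *)
Lemma besov_weight_infty_pointwise T a (Om : R -> \bar R) (M : R) : 0 < a ->
  monotone_modulus Om -> (besov_weight T a +oo Om <= M%:E)%E -> 0 <= M ->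
  forall t, 0 < t < T -> (Om t <= (2 `^ a * M * t `^ a)%:E)%E.
Proof.
move=> a0 [mon pos] HM M0 t /andP[t0 tT].
have /(@Lnormy_patch_leP R `]0, T]%classic) H := HM.
have {}H : {ae leb, forall x : R, 0 < x <= T -> (Om x <= (M * x `^ a)%:E)%E}.
  have : {ae leb, forall x : R, 0 < x <= T -> (Om x / (x `^ a)%:E <= M%:E)%E}.
    by apply: H; [rewrite lee_fin|move=> x /andP[x0 _]; rewrite weight_ge0// pos].
  apply: ae_imply => x + /[dup] xT /andP[x0 _] => /(_ xT).
  by rewrite lee_pdivr_EFin ?powR_gt0.
have l2 : t < Num.min T (2 * t) by rewrite lt_min tT/=; lra.
have lT : Num.min T (2 * t) <= T by rewrite ge_min lexx.
have [t' [tt' + Ht']] := exists_ae_between H (ltW t0) l2 lT.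
rewrite le_min => /andP[t'T t'2].
apply: (le_trans (mon _ _ (ltW tt'))); apply: (le_trans Ht'); rewrite lee_fin.
rewrite mulrAC -powRM ?(ltW t0)// mulrC ler_wpM2r//.
by apply: ge0_ler_powR => //; rewrite ?nnegrE ?(ltW a0)// ?mulr_ge0 ?(ltW t0)// (le_trans (ltW t0) (ltW tt')).
Qed.

End Outer.

(** * Weighted Lebesgue quasi-norms *)

Section Quasinorm.
Context {R : realType}.
Local Notation leb := (@lebesgue_measure R).

Lemma poweR_add_le (r : R) (x y : \bar R) : 0 <= r -> (0 <= x)%E -> (0 <= y)%E ->
  ((x + y) `^ r <= (2 `^ r)%:E * (x `^ r + y `^ r))%E.
Proof.
move=> r0; wlog xy : x y / (x <= y)%E => [H|] x0 y0.
  have [xy|/ltW yx] := leP x y; first exact: H.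
  by rewrite addeC [X in (_ * X)%E]addeC; exact: H.
apply: (@le_trans _ _ ((2%:E * y) `^ r)%E).
  apply: le_poweR => //; first exact: adde_ge0.
  by rewrite -[2%:E]/(1%:E + 1%:E)%E ge0_muleDl// !mul1e leeD2r.
rewrite poweRM// poweR_EFin; apply: lee_wpmul2l; first by rewrite lee_fin powR_ge0.
by rewrite leeDr// poweR_ge0.
Qed.

(** Covers the norm in s (weight 1) and the norm in t (a power of t), for all
    exponents q > 0, including those for which it is only a quasi-norm. *)
Definition wLq (q : R) (D : set R) (om : R -> R) (f : R -> \bar R) : \bar R :=
  ((\int[leb]_(t in D) (f t `^ q * (om t)%:E)) `^ q^-1)%E.

Section wLq.
Variables (q : R) (D : set R) (om : R -> R).
Hypotheses (q0 : 0 < q) (mD : measurable D) (mom : measurable_fun D om).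
Hypothesis om0 : forall t, D t -> 0 <= om t.

Let I f := (\int[leb]_(t in D) (f t `^ q * (om t)%:E))%E.

Let I0 f : (0 <= I f)%E.
Proof. by apply: integral_ge0 => t Dt; rewrite mule_ge0 ?poweR_ge0// lee_fin om0. Qed.

Let mI f : measurable_fun D f -> measurable_fun D (fun t => f t `^ q * (om t)%:E)%E.
Proof.
move=> mf; apply: emeasurable_funM; last exact/measurable_EFinP.
exact: (measurableT_comp (measurable_poweR q)).
Qed.

Let q1 : 0 <= q^-1. Proof. by rewrite invr_ge0 ltW. Qed.

Lemma wLq_add (f1 f2 f3 : R -> \bar R) :
  measurable_fun D f1 -> measurable_fun D f2 ->
  (forall t, D t -> (0 <= f1 t)%E) -> (forall t, D t -> (0 <= f2 t)%E) ->
  (forall t, D t -> (0 <= f3 t)%E) -> (forall t, D t -> (f3 t <= f1 t + f2 t)%E) ->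
  (wLq q D om f3 <= (2 * 2 `^ q^-1)%:E * (wLq q D om f1 + wLq q D om f2))%E.
Proof.
move=> m1 m2 p1 p2 p3 f12.
have H : (I f3 <= (2 `^ q)%:E * (I f1 + I f2))%E.
  rewrite /I -ge0_integralD//; last 4 first.
  - by move=> t Dt; rewrite mule_ge0 ?poweR_ge0// lee_fin om0.
  - exact: mI.
  - by move=> t Dt; rewrite mule_ge0 ?poweR_ge0// lee_fin om0.
  - exact: mI.
  rewrite -ge0_integralZl_EFin ?powR_ge0//; last 2 first.
  - by move=> t Dt; rewrite adde_ge0// mule_ge0 ?poweR_ge0// lee_fin om0.
  - by apply: emeasurable_funD; exact: mI.
  apply: ge0_le_lower_integral => t Dt.
    by rewrite mule_ge0 ?poweR_ge0// lee_fin om0.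
  rewrite -ge0_muleDl ?poweR_ge0// muleA; apply: lee_wpmul2r.
    by rewrite lee_fin om0.
  apply: le_trans (poweR_add_le (ltW q0) (p1 _ Dt) (p2 _ Dt)).
  by apply: le_poweR; [exact: ltW|exact: p3|exact: f12].
apply: (le_trans (le_poweR q1 (I0 f3) H)).
have I12 : (0 <= I f1 + I f2)%E := adde_ge0 (I0 f1) (I0 f2).
rewrite poweRM ?lee_fin ?powR_ge0// poweR_EFin -powRrM mulfV ?gt_eqF//.
rewrite powRr1// EFinM -muleA; apply: lee_wpmul2l; first by rewrite lee_fin.
by apply: poweR_add_le.
Qed.

Lemma wLq_scale (l : R) (f1 f2 : R -> \bar R) : 0 <= l -> measurable_fun D f1 ->
  (forall t, D t -> (0 <= f1 t)%E) -> (forall t, D t -> (0 <= f2 t)%E) ->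
  (forall t, D t -> (f2 t <= l%:E * f1 t)%E) ->
  (wLq q D om f2 <= l%:E * wLq q D om f1)%E.
Proof.
move=> l0 m1 p1 p2 f12.
have H : (I f2 <= (l `^ q)%:E * I f1)%E.
  rewrite -ge0_integralZl_EFin ?powR_ge0//; last 2 first.
  - by move=> t Dt; rewrite mule_ge0 ?poweR_ge0// lee_fin om0.
  - exact: mI.
  apply: ge0_le_lower_integral => t Dt.
    by rewrite mule_ge0 ?poweR_ge0// lee_fin om0.
  rewrite muleA; apply: lee_wpmul2r; first by rewrite lee_fin om0.
  rewrite -poweR_EFin -poweRM ?lee_fin ?p1//.
  by apply: le_poweR; [exact: ltW|exact: p2|exact: f12].
apply: (le_trans (le_poweR q1 (I0 f2) H)).
rewrite poweRM ?lee_fin ?powR_ge0// poweR_EFin -powRrM mulfV ?gt_eqF//.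
by rewrite powRr1.
Qed.

Lemma wLq_eq0 (f : R -> \bar R) : measurable_fun D f ->
  (forall t, D t -> (0 <= f t)%E) -> (forall t, D t -> 0 < om t) ->
  wLq q D om f = 0%E -> {ae leb, forall t, D t -> f t = 0%E}.
Proof.
move=> mf p om1 /(poweR_eq0_eq0 (I0 f)) H.
have : (\int[leb]_(t in D) `|f t `^ q * (om t)%:E| = 0)%E.
  rewrite -[RHS]H; apply: eq_integral => t /set_mem Dt.
  by rewrite gee0_abs// mule_ge0 ?poweR_ge0// lee_fin om0.
move/(@ae_eq_integral_abs _ _ _ leb D mD _ (mI mf)).1; apply: ae_imply => t + Dt => /(_ Dt) /eqP.
rewrite mule_eq0 => /orP[/eqP /(poweR_eq0_eq0 (p _ Dt))//|].
by rewrite eqe gt_eqF// om1.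
Qed.

End wLq.

Lemma wLq_square (q : R) D om (f1 f2 : R -> \bar R) : 0 < q ->
  (forall t, D t -> 0 <= om t) ->
  (forall t, D t -> (0 <= f1 t)%E) -> (forall t, D t -> (0 <= f2 t)%E) ->
  (forall t, D t -> (f2 t <= f1 t * f1 t)%E) ->
  (wLq (q / 2) D om f2 <= wLq q D om f1 * wLq q D om f1)%E.
Proof.
move=> q0 om0 p1 p2 f12; have q20 : 0 < q / 2 by rewrite divr_gt0.
rewrite /wLq -poweRM; last 2 first.
- by apply: integral_ge0 => t Dt; rewrite mule_ge0 ?poweR_ge0// lee_fin om0.
- by apply: integral_ge0 => t Dt; rewrite mule_ge0 ?poweR_ge0// lee_fin om0.
set I1 := (\int[leb]_(t in D) (f1 t `^ q * _))%E.
have I10 : (0 <= I1)%E.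
  by apply: integral_ge0 => t Dt; rewrite mule_ge0 ?poweR_ge0// lee_fin om0.
have -> : ((I1 * I1) `^ q^-1 = I1 `^ (q / 2)^-1)%E.
  have -> : (q / 2)^-1 = 2 * q^-1 by rewrite invf_div mulrC.
  rewrite poweRrM; congr (_ `^ _)%E.
  have -> : (2 : R) = 1 + 1 by [].
  by rewrite poweRD ?poweRe1//; apply/implyP; rewrite gt_eqF.
apply: le_poweR; first by rewrite invr_ge0 ltW.
  by apply: integral_ge0 => t Dt; rewrite mule_ge0 ?poweR_ge0// lee_fin om0.
apply: ge0_le_lower_integral => t Dt.
  by rewrite mule_ge0 ?poweR_ge0// lee_fin om0.
apply: lee_wpmul2r; first by rewrite lee_fin om0.
apply: (le_trans (le_poweR (ltW q20) (p2 _ Dt) (f12 _ Dt))).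
rewrite poweRM ?p1// -poweRD; last by apply/implyP; rewrite gt_eqF// addr_gt0.
by rewrite -splitr.
Qed.

Lemma ae_conj (A B : R -> Prop) : {ae leb, forall x, A x} -> {ae leb, forall x, B x} ->
  {ae leb, forall x, A x /\ B x}.
Proof.
move=> HA HB; have := negligibleU HA HB; apply: negligibleS => x /= nAB.
by apply: contrapT => /not_orP[/contrapT a /contrapT b]; exact: nAB.
Qed.

Section Ly.
Variable (D : set R).
Local Notation Ny f := ('N[leb]_+oo[f \_ D])%E.

Lemma Lnormy_ae (f : R -> \bar R) : (forall x : R, D x -> (0 <= f x)%E) ->
  {ae leb, forall x : R, D x -> (f x <= Ny f)%E}.
Proof. by move=> f0; apply/Lnormy_patch_leP => //; exact: Lnorm_ge0. Qed.

Lemma Lnormy_add (f1 f2 f3 : R -> \bar R) :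
  (forall t, D t -> (0 <= f1 t)%E) -> (forall t, D t -> (0 <= f2 t)%E) ->
  (forall t, D t -> (0 <= f3 t)%E) -> (forall t, D t -> (f3 t <= f1 t + f2 t)%E) ->
  (Ny f3 <= Ny f1 + Ny f2)%E.
Proof.
move=> p1 p2 p3 f12; apply/Lnormy_patch_leP => //; first by rewrite adde_ge0// Lnorm_ge0.
have := ae_conj (Lnormy_ae p1) (Lnormy_ae p2); apply: ae_imply => t [H1 H2] Dt.
by apply: (le_trans (f12 _ Dt)); apply: leeD; [exact: H1|exact: H2].
Qed.

Lemma Lnormy_scale (l : R) (f1 f2 : R -> \bar R) : 0 <= l ->
  (forall t, D t -> (0 <= f1 t)%E) -> (forall t, D t -> (0 <= f2 t)%E) ->
  (forall t, D t -> (f2 t <= l%:E * f1 t)%E) ->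
  (Ny f2 <= l%:E * Ny f1)%E.
Proof.
move=> l0 p1 p2 f12; apply/Lnormy_patch_leP => //; first by rewrite mule_ge0// Lnorm_ge0.
apply: ae_imply (Lnormy_ae p1) => t H1 Dt.
by apply: (le_trans (f12 _ Dt)); apply: lee_wpmul2l => //; exact: H1.
Qed.

Lemma Lnormy_square (f1 f2 : R -> \bar R) :
  (forall t, D t -> (0 <= f1 t)%E) -> (forall t, D t -> (0 <= f2 t)%E) ->
  (forall t, D t -> (f2 t <= f1 t * f1 t)%E) ->
  (Ny f2 <= Ny f1 * Ny f1)%E.
Proof.
move=> p1 p2 f12; apply/Lnormy_patch_leP => //; first by rewrite mule_ge0// Lnorm_ge0.
apply: ae_imply (Lnormy_ae p1) => t H1 Dt.
by apply: (le_trans (f12 _ Dt)); apply: lee_pmul => //; try exact: p1; exact: H1.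
Qed.

End Ly.
End Quasinorm.

(** * Quasi-norm properties of the weight in t *)

Section BesovQuasinorm.
Context {R : realType}.
Local Notation leb := (@lebesgue_measure R).
Implicit Types (T a t h : R) (p q : \bar R).

Section Weight.
Variables (T a : R).

Let pw (e : R) := fun t : R => t `^ e.
Let mpw e : measurable_fun `]0%R, T] (pw e).
Proof. exact: measurable_funTS (measurable_powR e). Qed.

Let D0 t : `]0%R, T]%classic t -> 0 < t.
Proof. by rewrite /= in_itv/= => /andP[]. Qed.

Lemma besov_weight_wLq (q : R) (Om : R -> \bar R) : (forall t, 0 < t -> (0 <= Om t)%E) ->
  besov_weight T a q%:E Om = wLq q `]0%R, T] (fun t => t `^ (- (a * q) - 1)) Om.
Proof. by move=> O0; rewrite besov_weight_finE// => t t0 _; exact: O0. Qed.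

Let W (Om : R -> \bar R) := fun t => (Om t / (t `^ a)%:E)%E.

Let W0 (Om : R -> \bar R) : (forall t, 0 < t -> (0 <= Om t)%E) ->
  forall t, `]0%R, T]%classic t -> (0 <= W Om t)%E.
Proof. by move=> O0 t /D0 t0; rewrite weight_ge0// O0. Qed.

Lemma besov_weight_add q : (0 < q)%E -> exists2 K : R, 0 < K &
  forall Om1 Om2 : R -> \bar R, monotone_modulus Om1 -> monotone_modulus Om2 ->
  (besov_weight T a q (fun t => Om1 t + Om2 t) <=
   K%:E * (besov_weight T a q Om1 + besov_weight T a q Om2))%E.
Proof.
case: q => [q| |]// q0.
  rewrite lte_fin in q0; exists (2 * 2 `^ q^-1); first by rewrite mulr_gt0// powR_gt0.
  move=> Om1 Om2 [m1 p1] [m2 p2].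
  rewrite !besov_weight_wLq//; last by move=> t t0; rewrite adde_ge0 ?p1 ?p2.
  apply: wLq_add => //.
  - exact: mpw.
  - by move=> t _; exact: powR_ge0.
  - exact: emonotone_measurable.
  - exact: emonotone_measurable.
  - by move=> t /D0; exact: p1.
  - by move=> t /D0; exact: p2.
  - by move=> t /D0 t0; rewrite adde_ge0 ?p1 ?p2.
exists 1 => // Om1 Om2 [m1 p1] [m2 p2]; rewrite mul1e.
apply: Lnormy_add; [exact: W0|exact: W0| |].
  by apply: W0 => t t0; rewrite adde_ge0 ?p1 ?p2.
by move=> t /D0 t0; rewrite inver gt_eqF ?powR_gt0// ge0_muleDl ?p1 ?p2.
Qed.

Lemma besov_weight_scale q (l : R) (Om1 Om2 : R -> \bar R) : (0 < q)%E -> 0 <= l ->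
  monotone_modulus Om1 -> (forall t, 0 < t -> (0 <= Om2 t)%E) ->
  (forall t, 0 < t -> t <= T -> (Om2 t <= l%:E * Om1 t)%E) ->
  (besov_weight T a q Om2 <= l%:E * besov_weight T a q Om1)%E.
Proof.
case: q => [q| |]// q0 l0 [m1 p1] p2 H.
  rewrite lte_fin in q0; rewrite !besov_weight_wLq//; apply: wLq_scale => //.
  - exact: mpw.
  - by move=> t _; exact: powR_ge0.
  - exact: emonotone_measurable.
  - by move=> t /D0; exact: p1.
  - by move=> t /D0; exact: p2.
  - by move=> t; rewrite /= in_itv/= => /andP[t0 tT]; exact: H.
apply: Lnormy_scale => //; [exact: W0|exact: W0|].
move=> t; rewrite /= in_itv/= => /andP[t0 tT]; rewrite inver gt_eqF ?powR_gt0// muleA.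
by apply: lee_wpmul2r; [rewrite lee_fin invr_ge0 powR_ge0|exact: H].
Qed.

(** For q = +oo no averaging is needed: the pointwise bound of order t^a is inserted
    into the hypothesis.  It misses only the end point T, a null set. *)
Lemma besov_weight_hardy q (y C0 : R) : (0 < q)%E -> 0 < a -> 0 < y -> 0 < C0 ->
  2 `^ (- a) < y ->
  exists2 C : R, 0 < C & forall Om1 Om2 : R -> \bar R,
    monotone_modulus Om2 -> (forall t, 0 < t -> (0 <= Om1 t)%E) ->
    (forall (t : R) (Y : \bar R), 0 < t -> t <= T -> (0 <= Y)%E ->
       (forall n, (Om2 (t / 2 ^+ n)%R <= Y * (y ^+ n)%:E)%E) ->
       (Om1 t <= C0%:E * Y)%E) ->
    (besov_weight T a q Om1 <= C%:E * besov_weight T a q Om2)%E.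
Proof.
case: q => [q| |]// q0 a0 y0 C00 ay.
  by apply: besov_weight_hardy_fin.
have C1 : 0 < C0 * 2 `^ a by rewrite mulr_gt0// powR_gt0.
exists (C0 * 2 `^ a) => // Om1 Om2 mon O1 H.
have := besov_weight_ge0 T a +oo%E Om2.
case EM : (besov_weight T a +oo Om2) => [M| |]// M0; last first.
  by rewrite gt0_muley ?leey.
rewrite lee_fin in M0.
have O2 := besov_weight_infty_pointwise a0 mon (eq_ind_r (fun x => x <= _)%E (lexx M%:E) EM) M0.
apply/Lnormy_patch_leP; first by rewrite lee_fin mulr_ge0// ltW.
  exact: W0.
exists [set T]; split; [by []|exact: lebesgue_measure_set1|].
move=> t /= /not_implyP[]; rewrite in_itv/= => /andP[t0 tT] nle.
apply/eqP; rewrite eq_le tT/= leNgt; apply/negP => ltT; apply: nle.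
rewrite lee_pdivr_EFin ?powR_gt0//.
have Y0 : 0 <= 2 `^ a * M * t `^ a by rewrite !mulr_ge0 ?powR_ge0.
apply: (le_trans (H t (2 `^ a * M * t `^ a)%:E t0 tT _ _)).
- by rewrite lee_fin.
- move=> n; have tn0 : 0 < t / 2 ^+ n by rewrite divr_gt0// exprn_gt0.
  have tnT : t / 2 ^+ n < T.
    apply: le_lt_trans ltT; rewrite ler_pdivrMr ?exprn_gt0// ler_peMr ?(ltW t0)//.
    by rewrite exprn_ege1// ler1n.
  apply: (le_trans (O2 _ _)); first by rewrite tn0.
  rewrite -EFinM lee_fin powRM ?invr_ge0 ?exprn_ge0 ?(ltW t0)// mulrA ler_wpM2l//.
  rewrite powR_inv ?exprn_ge0// powRX// -exprVn -powRN.
  by apply: lerXn2r; rewrite ?nnegrE ?powR_ge0 ?(ltW y0)// ltW.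
- by rewrite -!EFinM lee_fin !mulrA.
Qed.

(** A modulus that vanishes almost everywhere vanishes everywhere below T, by
    monotonicity. *)
Lemma besov_weight_eq0 q (Om : R -> \bar R) : (0 < q)%E -> 0 < a ->
  monotone_modulus Om -> besov_weight T a q Om = 0%E ->
  forall t, 0 < t -> t < T -> Om t = 0%E.
Proof.
case: q => [q| |]// q0 a0 [mon pos] H t t0 tT; apply/eqP; rewrite eq_le pos// andbT.
  rewrite lte_fin in q0; rewrite besov_weight_wLq// in H.
  have mOm : measurable_fun `]0%R, T] Om by exact: emonotone_measurable.
  have Hae := wLq_eq0 (measurable_itv _) (@mpw (- (a * q) - 1))
    (fun t _ => powR_ge0 _ _) mOm (fun t Dt => pos t (D0 Dt))
    (fun t Dt => powR_gt0 _ (D0 Dt)) H.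
  have {}Hae : {ae leb, forall t, 0 < t <= T -> Om t = 0%E}.
    by apply: ae_imply Hae => s + sT; apply; rewrite /= in_itv.
  have [s [ts sT <-]] := exists_ae_between Hae (ltW t0) tT (lexx _).
  exact/mon/ltW.
have := @besov_weight_infty_pointwise _ T a Om 0 a0 (conj mon pos).
rewrite H lexx => /(_ isT (lexx _) t); rewrite t0 tT => /(_ isT).
by rewrite mulr0 mul0r.
Qed.

End Weight.

Lemma besov_weight_square T a q (Om1 Om2 : R -> \bar R) : (0 < q)%E ->
  (forall t, 0 < t -> (0 <= Om1 t)%E) -> (forall t, 0 < t -> (0 <= Om2 t)%E) ->
  (forall t, 0 < t -> t <= T -> (Om2 t <= Om1 t * Om1 t)%E) ->
  (besov_weight T (2 * a) (q / 2%:E) Om2 <=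
   besov_weight T a q Om1 * besov_weight T a q Om1)%E.
Proof.
have D0 t : `]0%R, T]%classic t -> 0 < t by rewrite /= in_itv/= => /andP[].
case: q => [q| |]// q0 p1 p2 H.
  rewrite lte_fin in q0; have -> : (q%:E / 2%:E)%E = (q / 2)%:E by rewrite inver pnatr_eq0.
  rewrite !besov_weight_wLq//.
  have -> : 2 * a * (q / 2) = a * q by field.
  apply: wLq_square => //.
  - by move=> t _; exact: powR_ge0.
  - by move=> t /D0; exact: p1.
  - by move=> t /D0; exact: p2.
  - by move=> t; rewrite /= in_itv/= => /andP[t0 tT]; exact: H.
have -> : (+oo / 2%:E)%E = +oo%E :> \bar R.
  by rewrite inver pnatr_eq0/= gt0_mulye// lte_fin invr_gt0.
apply: Lnormy_square.
- by move=> t /D0 t0; rewrite weight_ge0// p1.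
- by move=> t /D0 t0; rewrite weight_ge0// p2.
move=> t; rewrite /= in_itv/= => /andP[t0 tT].
rewrite !inver !gt_eqF ?powR_gt0// muleACA -EFinM -invfM.
have -> : t `^ a * t `^ a = t `^ (2 * a).
  rewrite -powRD; last by apply/implyP => _; rewrite gt_eqF.
  by congr (_ `^ _); ring.
by apply: lee_wpmul2r; [rewrite lee_fin invr_ge0 powR_ge0|exact: H].
Qed.

End BesovQuasinorm.

(** * Besov quasi-norms of two-parameter functions *)

Section BesovReal.
Context {R : realType}.
Local Notation leb := (@lebesgue_measure R).
Implicit Types (T a t h : R) (p q : \bar R) (g : R -> R -> R).

Definition admissible T g := nonneg2 T g /\ continuous2 T g.

Definition quasi_const p : R := if p is P%:E then 2 * 2 `^ P^-1 else 1.

Lemma quasi_const_gt0 p : 0 < quasi_const p.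
Proof. by case: p => [P| |]//=; rewrite mulr_gt0// powR_gt0. Qed.

Lemma quasi_const_ge0 p : 0 <= quasi_const p.
Proof. exact/ltW/quasi_const_gt0. Qed.

Section Slice.
Variables (T h : R).
Hypothesis h0 : 0 < h.

Local Notation slice g := (fun s : R => (g s (s + h)%R)%:E).
Local Notation D := (`[0%R, (T - h)%R]%classic).
Local Notation N p g := ('N[leb]_p[(fun s => EFin2 g s (s + h)%R) \_ D])%E.

Let slice_ge0 g : nonneg2 T g -> forall s, D s -> (0 <= slice g s)%E.
Proof.
move=> g0 s; rewrite /= in_itv/= => /andP[s0 sT]; rewrite lee_fin g0 ?lerDl ?(ltW h0)//.
by rewrite -lerBrDr.
Qed.

Let slice_meas g : continuous2 T g -> measurable_fun D (slice g).
Proof.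
move=> gc; apply/measurable_EFinP.
have -> : (fun s => g s (s + h)) = (fun s => g (s + 0) (s + 0 + h)).
  by apply/funext => s; rewrite addr0.
by apply: (measurable_slice gc) => //; [exact: ltW|rewrite addr0 subrK].
Qed.

Let N_wLq (P : R) g : 0 < P -> nonneg2 T g ->
  N P%:E g = wLq P D (fun=> 1) (slice g).
Proof.
move=> P0 g0; rewrite Lnorm_restrictE//; last first.
  by move=> s sD; apply: (slice_ge0 g0); rewrite /= in_itv.
by rewrite /wLq; under [in RHS]eq_integral do rewrite mule1.
Qed.

Let m1 : measurable_fun D (fun=> 1 : R). Proof. exact: measurable_cst. Qed.

Lemma slice_norm_add p g1 g2 g3 : (0 < p)%E ->
  admissible T g1 -> admissible T g2 -> nonneg2 T g3 ->
  (forall s t, 0 <= s -> s <= t -> t <= T -> g3 s t <= g1 s t + g2 s t) ->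
  (N p g3 <= (quasi_const p)%:E * (N p g1 + N p g2))%E.
Proof.
move=> p0 [g10 g1c] [g20 g2c] g30 H.
have HD s : D s -> (slice g3 s <= slice g1 s + slice g2 s)%E.
  rewrite /= in_itv/= => /andP[s0 sT]; rewrite -EFinD lee_fin H ?lerDl ?(ltW h0)//.
  by rewrite -lerBrDr.
case: p p0 => [P| |]// p0.
  rewrite lte_fin in p0; rewrite !N_wLq//; apply: wLq_add => //.
  - exact: slice_meas.
  - exact: slice_meas.
  - exact: slice_ge0.
  - exact: slice_ge0.
  - exact: slice_ge0.
rewrite mul1e; apply: Lnormy_add => //; exact: slice_ge0.
Qed.

Lemma slice_norm_scale p l g1 g2 : (0 < p)%E -> 0 <= l ->
  admissible T g1 -> nonneg2 T g2 ->
  (forall s t, 0 <= s -> s <= t -> t <= T -> g2 s t <= l * g1 s t) ->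
  (N p g2 <= l%:E * N p g1)%E.
Proof.
move=> p0 l0 [g10 g1c] g20 H.
have HD s : D s -> (slice g2 s <= l%:E * slice g1 s)%E.
  rewrite /= in_itv/= => /andP[s0 sT]; rewrite -EFinM lee_fin H ?lerDl ?(ltW h0)//.
  by rewrite -lerBrDr.
case: p p0 => [P| |]// p0.
  rewrite lte_fin in p0; rewrite !N_wLq//; apply: wLq_scale => //.
  - exact: slice_meas.
  - exact: slice_ge0.
  - exact: slice_ge0.
apply: Lnormy_scale => //; exact: slice_ge0.
Qed.

Lemma slice_norm_square p g1 g2 : (0 < p)%E -> nonneg2 T g1 -> nonneg2 T g2 ->
  (forall s t, 0 <= s -> s <= t -> t <= T -> g2 s t <= g1 s t ^+ 2) ->
  (N (p / 2%:E) g2 <= N p g1 * N p g1)%E.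
Proof.
move=> p0 g10 g20 H.
have HD s : D s -> (slice g2 s <= slice g1 s * slice g1 s)%E.
  rewrite /= in_itv/= => /andP[s0 sT]; rewrite -EFinM -expr2 lee_fin H ?lerDl ?(ltW h0)//.
  by rewrite -lerBrDr.
case: p p0 => [P| |]// p0.
  have -> : (P%:E / 2%:E)%E = (P / 2)%:E by rewrite inver pnatr_eq0.
  rewrite lte_fin in p0; rewrite !N_wLq// ?divr_gt0//; apply: wLq_square => //.
  - exact: slice_ge0.
  - exact: slice_ge0.
have -> : (+oo / 2%:E)%E = +oo%E :> \bar R.
  by rewrite inver pnatr_eq0/= gt0_mulye// lte_fin invr_gt0.
apply: Lnormy_square => //; exact: slice_ge0.
Qed.

Lemma slice_norm_eq0 p g : (0 < p)%E -> h < T -> admissible T g ->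
  N p g = 0%E -> forall s, 0 <= s <= T - h -> g s (s + h) = 0.
Proof.
move=> p0 hT' [g0 gc] H s sT.
have gs0 : 0 <= g s (s + h).
  by have := slice_ge0 g0; rewrite -lee_fin; apply; rewrite /= in_itv.
apply/eqP; rewrite eq_le gs0 andbT -lee_fin.
apply: (ae_le_slice gc (ltW h0) hT') sT.
have dD x : 0 <= x <= T - h -> D x by rewrite /= in_itv.
case: p p0 H => [P| |]// p0 H.
  rewrite lte_fin in p0; rewrite N_wLq// in H.
  have := wLq_eq0 (measurable_itv _) m1 (fun _ _ => ler01) (slice_meas gc)
    (slice_ge0 g0) (fun _ _ => ltr01) H.
  by apply: ae_imply => x Hx /dD /Hx ->.
have H' : (N +oo%E g <= 0)%E by rewrite H.
apply: ae_imply (Lnormy_ae (slice_ge0 g0)) => x Hx /dD /Hx Nx.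
exact: le_trans Nx H'.
Qed.

End Slice.

Lemma besov_modulus_add T p g1 g2 g3 t : (0 < p)%E -> t <= T ->
  admissible T g1 -> admissible T g2 -> nonneg2 T g3 ->
  (forall s t, 0 <= s -> s <= t -> t <= T -> g3 s t <= g1 s t + g2 s t) ->
  (besov_modulus T p (EFin2 g3) t <= (quasi_const p)%:E *
    (besov_modulus T p (EFin2 g1) t + besov_modulus T p (EFin2 g2) t))%E.
Proof.
move=> p0 tT a1 a2 g30 H; apply: ge_ereal_sup => _ [h /= + <-].
rewrite in_itv/= => /andP[h0 ht]; have hT := le_trans ht tT.
apply: le_trans (slice_norm_add h0 p0 a1 a2 g30 H) _.
apply: lee_wpmul2l; first by rewrite lee_fin quasi_const_ge0.
by apply: leeD; apply: (besov_modulus_ge_slice T p (EFin2 _)).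
Qed.

Lemma besov_modulus_scale T p l g1 g2 t : (0 < p)%E -> t <= T -> 0 <= l ->
  admissible T g1 -> nonneg2 T g2 ->
  (forall s t, 0 <= s -> s <= t -> t <= T -> g2 s t <= l * g1 s t) ->
  (besov_modulus T p (EFin2 g2) t <= l%:E * besov_modulus T p (EFin2 g1) t)%E.
Proof.
move=> p0 tT l0 a1 g20 H; apply: ge_ereal_sup => _ [h /= + <-].
rewrite in_itv/= => /andP[h0 ht]; have hT := le_trans ht tT.
apply: le_trans (slice_norm_scale h0 p0 l0 a1 g20 H) _.
apply: lee_wpmul2l; first by rewrite lee_fin.
exact: (besov_modulus_ge_slice T p (EFin2 _)).
Qed.

Lemma besov_modulus_square T p g1 g2 t : (0 < p)%E -> t <= T ->
  nonneg2 T g1 -> nonneg2 T g2 ->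
  (forall s t, 0 <= s -> s <= t -> t <= T -> g2 s t <= g1 s t ^+ 2) ->
  (besov_modulus T (p / 2%:E) (EFin2 g2) t <=
   besov_modulus T p (EFin2 g1) t * besov_modulus T p (EFin2 g1) t)%E.
Proof.
move=> p0 tT g10 g20 H; apply: ge_ereal_sup => _ [h /= + <-].
rewrite in_itv/= => /andP[h0 ht]; have hT := le_trans ht tT.
apply: le_trans (slice_norm_square h0 p0 g10 g20 H) _.
by apply: lee_pmul; rewrite ?Lnorm_ge0//; apply: (besov_modulus_ge_slice T p (EFin2 _)).
Qed.

Section Besov.
Variables (T a : R) (p q : \bar R).
Hypotheses (p0 : (0 < p)%E) (q0 : (0 < q)%E).
Local Notation B g := (besov_norm T a p q (EFin2 g)).

Let mod_mon g : monotone_modulus (besov_modulus T p (EFin2 g)).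
Proof. exact: besov_modulus_mon. Qed.

Let mod_ge0 g t : 0 < t -> (0 <= besov_modulus T p (EFin2 g) t)%E.
Proof. by move=> t0; have [_ ->] := mod_mon g. Qed.

Lemma besov_norm_add : exists2 K : R, 0 < K & forall g1 g2 g3,
  admissible T g1 -> admissible T g2 -> nonneg2 T g3 ->
  (forall s t, 0 <= s -> s <= t -> t <= T -> g3 s t <= g1 s t + g2 s t) ->
  (B g3 <= K%:E * (B g1 + B g2))%E.
Proof.
have [K K0 HK] := besov_weight_add T a q0.
exists (quasi_const p * K); first by rewrite mulr_gt0// quasi_const_gt0.
move=> g1 g2 g3 a1 a2 g30 H; rewrite !besov_normE EFinM -muleA.
apply: (le_trans _ (lee_wpmul2l _ (HK _ _ (mod_mon g1) (mod_mon g2)))); last first.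
  by rewrite lee_fin quasi_const_ge0.
apply: besov_weight_scale => //.
- exact: quasi_const_ge0.
- split=> [s t st|t t0]; last by rewrite adde_ge0 ?mod_ge0.
  by apply: leeD; apply: (mod_mon _).1.
- exact: mod_ge0.
- by move=> t t0 tT; exact: besov_modulus_add.
Qed.

Lemma besov_norm_scale l g1 g2 : 0 <= l -> admissible T g1 -> nonneg2 T g2 ->
  (forall s t, 0 <= s -> s <= t -> t <= T -> g2 s t <= l * g1 s t) ->
  (B g2 <= l%:E * B g1)%E.
Proof.
move=> l0 a1 g20 H; rewrite !besov_normE; apply: besov_weight_scale => //.
- exact: mod_ge0.
- by move=> t t0 tT; exact: besov_modulus_scale.
Qed.

(** Halving both integrability exponents and doubling the smoothness turns the norm
    of a square into the square of a norm. *)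
Lemma besov_norm_square g1 g2 : nonneg2 T g1 -> nonneg2 T g2 ->
  (forall s t, 0 <= s -> s <= t -> t <= T -> g2 s t <= g1 s t ^+ 2) ->
  (besov_norm T (2 * a) (p / 2%:E) (q / 2%:E) (EFin2 g2) <= B g1 * B g1)%E.
Proof.
move=> g10 g20 H; rewrite !besov_normE; apply: besov_weight_square => //.
- exact: mod_ge0.
- by move=> t t0; apply: (besov_modulus_mon _ _ _).2.
- by move=> t t0 tT; exact: besov_modulus_square.
Qed.

(** A vanishing norm annihilates all slices almost everywhere, hence everywhere by
    continuity.  Steps h < T are reached in this way; the step T is halved. *)
Lemma besov_norm_eq0 g : 0 < a -> 0 < T -> admissible T g -> subadditive2 T g ->
  vanishes_on_diagonal T g -> B g = 0%E ->
  forall s t, 0 <= s -> s <= t -> t <= T -> g s t = 0.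
Proof.
move=> a0 T0 ag gS gd H.
have Z s t : 0 <= s -> s < t -> t <= T -> t - s < T -> g s t = 0.
  move=> s0 st tT tsT; have h0 : 0 < t - s by rewrite subr_gt0.
  have hm : t - s < (t - s + T) / 2 by lra.
  have hm2 : (t - s + T) / 2 < T by lra.
  have Mz := besov_weight_eq0 q0 a0 (mod_mon g) H (lt_trans h0 hm) hm2.
  have Nz : ('N[leb]_p[(fun x => EFin2 g x (x + (t - s))%R) \_ `[0%R, (T - (t - s))%R]] = 0)%E.
    apply/eqP; rewrite eq_le Lnorm_ge0 andbT -Mz.
    by apply: (besov_modulus_ge_slice T p (EFin2 g)) => //; exact: ltW.
  have := slice_norm_eq0 h0 p0 tsT ag Nz (s := s); rewrite subrKC; apply.
  by rewrite s0/=; lra.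
move=> s t s0; rewrite le_eqVlt => /orP[/eqP <- sT|st tT]; first by rewrite gd// s0.
have [tsT|Tts] := ltP (t - s) T; first exact: Z.
have s00 : s = 0 by lra.
have tT' : t = T by lra.
apply/eqP; rewrite eq_le ag.1// ?(ltW st)// andbT s00 tT'.
have T2 : T / 2 < T by lra.
have T20 : 0 < T / 2 by lra.
apply: (le_trans (gS 0 (T / 2) T _ _ _ _)) => //; try exact: ltW.
by rewrite !Z ?addr0//; lra.
Qed.

End Besov.

Lemma ltr_powR2 (x y : R) : x < y -> 2 `^ x < 2 `^ y :> R.
Proof.
by move=> xy; rewrite /powR pnatr_eq0 ltr_expR ltr_pM2r// ln_gt0// ltr1n.
Qed.

(** Because a rho > 1 there is y with 2^-a < y < 2^(-1/rho).  The lower bound is what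
    [besov_weight_hardy] needs, the upper one gives 2 y^rho < 1 and so leaves room
    for a chaining ratio z < 1 with 2 y^rho < (z^2)^rho. *)
Lemma besov_variation_bound T a p q rho : 0 < rho -> 1 < a * rho ->
  (rho%:E <= p)%E -> (0 < q)%E ->
  exists2 C : R, 0 < C & forall f w g, chainable T f w g ->
  (besov_norm T a p q (rho_variation rho (EFin2 f)) <=
   C%:E * besov_norm T a p q (EFin2 g))%E.
Proof.
move=> rho0 arho rp q0.
have a0 : 0 < a by rewrite -(pmulr_lgt0 _ rho0) (lt_trans ltr01).
pose b : R := 2 `^ (- rho^-1).
have ab : 2 `^ (- a) < b.
  by apply: ltr_powR2; rewrite ltrN2 -[ltLHS]mul1r ltr_pdivrMr.
have b1 : b < 1.
  by rewrite -[ltRHS](powRr0 2); apply: ltr_powR2; rewrite oppr_lt0 invr_gt0.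
have pa0 : 0 < 2 `^ (- a) :> R by exact: powR_gt0.
have b0 : 0 < b by exact: powR_gt0.
have brho : b `^ rho = 2^-1 by rewrite /b -powRrM mulNr mulVf ?gt_eqF// powR_inv1.
pose y := (2 `^ (- a) + b) / 2.
have y0 : 0 < y by rewrite divr_gt0// addr_gt0.
have ya : 2 `^ (- a) < y by rewrite /y; lra.
have yb : y < b by rewrite /y; lra.
pose v := (y / b + 1) / 2.
have yb1 : y / b < 1 by rewrite ltr_pdivrMr// mul1r.
have yb0 : 0 < y / b by rewrite divr_gt0.
have v0 : 0 < v by rewrite /v; lra.
have v1 : v < 1 by rewrite /v; lra.
have yv : y < v * b by rewrite -ltr_pdivrMr// /v; lra.
pose z := Num.sqrt v.
have z0 : 0 < z by rewrite sqrtr_gt0.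
have z2 : z ^+ 2 = v by rewrite sqr_sqrtr// ltW.
have z1 : z < 1 by rewrite -sqrtr1 ltr_sqrt.
have cy : 2 * ((z ^+ 2) `^ rho)^-1 * y `^ rho < 1.
  rewrite z2 mulrAC ltr_pdivrMr ?powR_gt0// mul1r -ltr_pdivlMl// mulrC -brho.
  rewrite -powRM ?(ltW v0) ?(ltW b0)//.
  have vb0 : 0 <= v * b by apply: mulr_ge0; exact: ltW.
  by apply: gt0_ltr_powR => //; rewrite nnegrE ltW.
have [C0 C00 HC] := modulus_bound z0 z1 rho0 y0 cy rp.
have [C C1 H] := besov_weight_hardy T q0 a0 y0 C00 ya.
exists C => // f w g ch; rewrite !besov_normE; apply: H.
- exact: besov_modulus_mon.
- by move=> t t0; apply: (besov_modulus_mon _ _ _).2.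
- by move=> t Y t0 tT Y0; exact: HC ch t0 tT Y0.
Qed.

End BesovReal.

(** * Variation of functions with a product defect *)

Section Abstract.
Context {R : realType}.
Implicit Types (T a : R) (p q : \bar R) (f g : R -> R -> R).

Lemma continuous2D T f g : continuous2 T f -> continuous2 T g ->
  continuous2 T (fun s t => f s t + g s t).
Proof. by move=> fc gc x; apply: cvgD; [exact: fc|exact: gc]. Qed.

Lemma continuous2M T f g : continuous2 T f -> continuous2 T g ->
  continuous2 T (fun s t => f s t * g s t).
Proof. by move=> fc gc x; apply: cvgM; [exact: fc|exact: gc]. Qed.

Lemma continuous2Z T (l : R) f : continuous2 T f -> continuous2 T (fun s t => l * f s t).
Proof. by move=> fc x; apply: cvgMr; exact: fc. Qed.

(** The norm of the increments of a continuous path has these properties, and unlike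
    such norms they are stable under sums and nonnegative multiples. *)
Definition pathlike T f :=
  [/\ nonneg2 T f, continuous2 T f, vanishes_on_diagonal T f & subadditive2 T f].

Lemma pathlikeD T f g : pathlike T f -> pathlike T g ->
  pathlike T (fun s t => f s t + g s t).
Proof.
move=> [f0 fc fd fS] [g0 gc gd gS]; split.
- by move=> s t s0 st tT; rewrite addr_ge0 ?f0 ?g0.
- exact: continuous2D.
- by move=> s s0; rewrite fd ?gd ?addr0.
- move=> s u t s0 su ut tT; rewrite addrACA.
  by apply: lerD; [exact: fS|exact: gS].
Qed.

Lemma pathlikeZ T (l : R) f : 0 <= l -> pathlike T f -> pathlike T (fun s t => l * f s t).
Proof.
move=> l0 [f0 fc fd fS]; split.
- by move=> s t s0 st tT; rewrite mulr_ge0 ?f0.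
- exact: continuous2Z.
- by move=> s s0; rewrite fd ?mulr0.
- by move=> s u t s0 su ut tT; rewrite -mulrDr ler_wpM2l ?fS.
Qed.

Definition sqr2 f : R -> R -> R := fun s t => f s t ^+ 2.

Lemma admissible_sqr T f : pathlike T f -> admissible T (sqr2 f).
Proof.
move=> [f0 fc _ _]; split; first by move=> *; exact: sqr_ge0.
exact: (continuous2M fc fc).
Qed.

Section Control.
Variables (T a : R) (p q : \bar R).
Hypotheses (T0 : 0 < T) (a0 : 0 < a) (p0 : (0 < p)%E) (q0 : (0 < q)%E).
Local Notation B1 f := (besov_norm T a p q (EFin2 f%R)).
Local Notation B2 f := (besov_norm T (2 * a) (p / 2%:E) (q / 2%:E) (EFin2 f%R)).

Let half_gt0 (x : \bar R) : (0 < x)%E -> (0 < x / 2%:E)%E.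
Proof.
by move=> x0; rewrite mule_gt0// inver pnatr_eq0 lte_fin invr_gt0.
Qed.

Let B2_ge0 f : (0 <= B2 f)%E. Proof. by rewrite besov_normE besov_weight_ge0. Qed.
Let B1_ge0 f : (0 <= B1 f)%E. Proof. by rewrite besov_normE besov_weight_ge0. Qed.

Lemma besov_norm_sqrD : exists2 K : R, 0 < K & forall f g, pathlike T f -> pathlike T g ->
  (B2 (sqr2 (fun s t => (f s t + g s t)%R)) <= K%:E * (B2 (sqr2 f) + B2 (sqr2 g)))%E.
Proof.
have [K K0 HK] := besov_norm_add T (2 * a) (half_gt0 p0) (half_gt0 q0).
exists (K * 2); first by rewrite mulr_gt0.
move=> f g Hf Hg.
have Sf := admissible_sqr Hf; have Sg := admissible_sqr Hg.
have Z u : admissible T u -> admissible T (fun s t => 2 * u s t).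
  by move=> [u0 uc]; split; [move=> s t *; rewrite mulr_ge0 ?u0|exact: continuous2Z].
apply: (le_trans (HK _ _ _ (Z _ Sf) (Z _ Sg) _ _)).
- by move=> s t *; exact: sqr_ge0.
- move=> s t _ _ _; rewrite /sqr2 -subr_ge0.
  have -> : 2 * f s t ^+ 2 + 2 * g s t ^+ 2 - (f s t + g s t) ^+ 2 = (f s t - g s t) ^+ 2.
    by ring.
  exact: sqr_ge0.
rewrite EFinM -muleA; apply: lee_wpmul2l; first by rewrite lee_fin ltW.
rewrite ge0_muleDr//; apply: leeD.
  by apply: besov_norm_scale => //; [exact: half_gt0|exact: half_gt0|exact: (Z _ Sf).1].
by apply: besov_norm_scale => //; [exact: half_gt0|exact: half_gt0|exact: (Z _ Sg).1].
Qed.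

Lemma besov_norm_sqrZ l f : pathlike T f ->
  (B2 (sqr2 (fun s t => l * f s t)%R) <= (l ^+ 2)%:E * (B1 f * B1 f))%E.
Proof.
move=> Hf; have Sf := admissible_sqr Hf; have [f0 _ _ _] := Hf.
apply: (@le_trans _ _ ((l ^+ 2)%:E * B2 (sqr2 f))%E).
  apply: besov_norm_scale; [exact: half_gt0|exact: half_gt0|exact: sqr_ge0|by []| |].
    by move=> s t *; exact: sqr_ge0.
  by move=> s t *; rewrite /sqr2 exprMn.
apply: lee_wpmul2l; first by rewrite lee_fin sqr_ge0.
by apply: besov_norm_square => //; exact: Sf.1.
Qed.

Lemma pathlike0 : pathlike T (fun _ _ => 0).
Proof.
split=> [//|x|//|s u t *]; [exact: cvg_cst|by rewrite addr0].
Qed.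

(** Take h = l f + g / l.  The norm of h^2 is of order l^2 U^2 + V^2 / l^2, where U
    and V are the norms of f and g, and l^2 = V/U makes both terms equal to U V.
    If U or V is 0 there is no such l, but then f or g vanishes identically and
    h = 0 will do, also when the other norm is infinite. *)
Lemma product_control : exists2 K : R, 0 < K &
  forall f g, pathlike T f -> pathlike T g ->
  exists h, [/\ pathlike T h,
    (forall s u t, 0 <= s -> s <= u -> u <= t -> t <= T ->
       f s u * g u t <= h s u * h u t) &
    (B2 (sqr2 h) <= K%:E * (B1 f * B1 g))%E].
Proof.
have [K K0 HK] := besov_norm_sqrD.
exists (K * 2); first by rewrite mulr_gt0.
move=> f g Hf Hg; have [f0 fc fd fS] := Hf; have [g0 gc gd gS] := Hg.
have zero_case : (forall s u t, 0 <= s -> s <= u -> u <= t -> t <= T ->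
     f s u * g u t <= 0) -> exists h, [/\ pathlike T h,
    (forall s u t, 0 <= s -> s <= u -> u <= t -> t <= T ->
       f s u * g u t <= h s u * h u t) &
    (B2 (sqr2 h) <= (K * 2)%:E * (B1 f * B1 g))%E].
  move=> fg0; exists (fun _ _ => 0); split; first exact: pathlike0.
    by move=> s u t *; rewrite mulr0 fg0.
  have := besov_norm_sqrZ 0 Hf; rewrite expr0n mul0e.
  have -> : sqr2 (fun s t => 0 * f s t) = sqr2 (fun _ _ => 0).
    by apply/funext => s; apply/funext => t; rewrite /sqr2 mul0r.
  by move=> /le_trans; apply; rewrite !mule_ge0// lee_fin mulr_ge0// ltW.
have [Bf0|Bf] := eqVneq (B1 f) 0%E.
  apply: zero_case => s u t s0 su ut tT.
  by rewrite (besov_norm_eq0 p0 q0 a0 T0 _ fS fd Bf0)// ?mul0r// (le_trans ut).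
have [Bg0|Bg] := eqVneq (B1 g) 0%E.
  apply: zero_case => s u t s0 su ut tT.
  by rewrite (besov_norm_eq0 p0 q0 a0 T0 _ gS gd Bg0)// ?mulr0// (le_trans s0).
have Bf1 : (0 < B1 f)%E by rewrite lt0e Bf B1_ge0.
have Bg1 : (0 < B1 g)%E by rewrite lt0e Bg B1_ge0.
have main l : 0 < l -> (forall s u t, 0 <= s -> s <= u -> u <= t -> t <= T ->
       f s u * g u t <= (l * f s u + l^-1 * g s u) * (l * f u t + l^-1 * g u t)).
  move=> l0 s u t s0 su ut tT.
  have -> : f s u * g u t = (l * f s u) * (l^-1 * g u t).
    by rewrite mulrACA divff ?mul1r// gt_eqF.
  have u0 := le_trans s0 su; have uT := le_trans ut tT.
  by apply: ler_pM; rewrite ?lerDl ?lerDr ?mulr_ge0 ?f0 ?g0 ?invr_ge0 ?(ltW l0).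
have Hl l : 0 < l -> pathlike T (fun s t => l * f s t + l^-1 * g s t).
  move=> l0; apply: pathlikeD; apply: pathlikeZ => //; first exact: ltW.
  by rewrite invr_ge0 ltW.
have [fin|] := boolP ((B1 f < +oo) && (B1 g < +oo))%E; last first.
  move=> ninf; exists (fun s t => 1 * f s t + 1^-1 * g s t); split.
  - exact: Hl.
  - exact: main.
  - have -> : (B1 f * B1 g = +oo)%E.
      move: ninf; rewrite negb_and -!leNgt !leye_eq => /orP[/eqP ->|/eqP ->].
        by rewrite gt0_mulye.
      by rewrite gt0_muley.
    by rewrite gt0_muley ?leey// lte_fin mulr_gt0.
case/andP: fin => Bfy Bgy.
pose U := fine (B1 f); pose V := fine (B1 g).
have UE : (B1 f = U%:E)%E by rewrite fineK// ge0_fin_numE.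
have VE : (B1 g = V%:E)%E by rewrite fineK// ge0_fin_numE.
have U0 : 0 < U by rewrite -lte_fin -UE.
have V0 : 0 < V by rewrite -lte_fin -VE.
pose l := Num.sqrt (V / U).
have l0 : 0 < l by rewrite sqrtr_gt0 divr_gt0.
have l2 : l ^+ 2 = V / U by rewrite sqr_sqrtr// divr_ge0// ltW.
exists (fun s t => l * f s t + l^-1 * g s t); split; [exact: Hl|exact: main|].
apply: (le_trans (HK _ _ (pathlikeZ (ltW l0) Hf) (pathlikeZ _ Hg))).
  by rewrite invr_ge0 ltW.
rewrite EFinM -muleA; apply: lee_wpmul2l; first by rewrite lee_fin ltW.
apply: (le_trans (leeD (besov_norm_sqrZ _ Hf) (besov_norm_sqrZ _ Hg))).
rewrite UE VE -!EFinM -EFinD lee_fin exprVn l2.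
have -> : V / U * (U * U) + (V / U)^-1 * (V * V) = 2 * (U * V).
  by field; rewrite ?gt_eqF.
by rewrite lexx.
Qed.

Variable rho : R.
Hypotheses (rho0 : 0 < rho) (arho : 1 < 2 * a * rho) (rp : (rho%:E <= p / 2%:E)%E).

(** Polarise both products into h1 and h2 and put w = h1 + h2; the mixed terms of
    w(s,u) w(u,t) are nonnegative.  Then [besov_variation_bound] applies with
    g = chi + w^2. *)
Theorem variation_product_bound : exists2 C : R, 0 < C &
  forall chi f1 g1 f2 g2, nonneg2 T chi -> continuous2 T chi ->
    vanishes_on_diagonal T chi ->
    pathlike T f1 -> pathlike T g1 -> pathlike T f2 -> pathlike T g2 ->
    (forall s u t, 0 <= s -> s <= u -> u <= t -> t <= T ->
       chi s t <= chi s u + chi u t + (f1 s u * g1 u t + f2 s u * g2 u t)) ->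
  (besov_norm T (2 * a) (p / 2%:E) (q / 2%:E) (rho_variation rho (EFin2 chi)) <=
     C%:E * (B2 chi + B1 f1 * B1 g1 + B1 f2 * B1 g2))%E.
Proof.
have [C C0 HC] := besov_variation_bound T rho0 arho rp (half_gt0 q0).
have [K1 K10 HK1] := besov_norm_add T (2 * a) (half_gt0 p0) (half_gt0 q0).
have [K2 K20 HK2] := besov_norm_sqrD.
have [K3 K30 HK3] := product_control.
pose K := Num.max 1 (K2 * K3).
have K1' : 1 <= K by rewrite le_max lexx.
exists (C * K1 * K); first by rewrite !mulr_gt0// (lt_le_trans ltr01).
move=> chi f1 g1 f2 g2 chi0 chic chid Hf1 Hg1 Hf2 Hg2 chiS.
have [h1 [Hh1 fgh1 Bh1]] := HK3 _ _ Hf1 Hg1.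
have [h2 [Hh2 fgh2 Bh2]] := HK3 _ _ Hf2 Hg2.
pose w s t := h1 s t + h2 s t; have Hw : pathlike T w by exact: pathlikeD.
have [w0 wc wd wS] := Hw; have [h10 _ _ _] := Hh1; have [h20 _ _ _] := Hh2.
pose g s t := chi s t + sqr2 w s t.
have ch : chainable T chi w g.
  split => //.
  - split=> // s u t s0 su ut tT; apply: (le_trans (chiS _ _ _ s0 su ut tT)).
    rewrite lerD2l; have u0 := le_trans s0 su; have uT := le_trans ut tT.
    apply: (le_trans (lerD (fgh1 _ _ _ s0 su ut tT) (fgh2 _ _ _ s0 su ut tT))).
    have h1su := h10 _ _ s0 su uT; have h1ut := h10 _ _ u0 ut tT.
    have h2su := h20 _ _ s0 su uT; have h2ut := h20 _ _ u0 ut tT.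
    rewrite /w mulrDl !mulrDr -!addrA lerD2l addrA lerDr.
    by rewrite addr_ge0// mulr_ge0.
  - split=> //; apply: continuous2D => //; exact: (admissible_sqr Hw).2.
  - move=> s t s0 st tT; rewrite /g lerDl lerDr chi0// sqr_ge0//.
apply: (le_trans (HC _ _ _ ch)).
rewrite !EFinM -!muleA; apply: lee_wpmul2l; first by rewrite lee_fin ltW.
have := HK1 _ _ g (conj chi0 chic) (admissible_sqr Hw) _ (fun _ _ _ _ _ => lexx _).
move=> /(_ _)/le_trans; apply.
  by move=> s t s0 st tT; rewrite addr_ge0 ?chi0 ?sqr_ge0.
apply: lee_wpmul2l; first by rewrite lee_fin ltW.
have KE : (0 <= K%:E)%E by rewrite lee_fin (le_trans ler01).
have B0 f f' : (0 <= B1 f * B1 f')%E by rewrite mule_ge0.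
rewrite -addeA ge0_muleDr ?adde_ge0//; apply: leeD.
  by rewrite lee_pemull.
apply: (le_trans (HK2 _ _ Hh1 Hh2)).
apply: (@le_trans _ _ ((K2 * K3)%:E * (B1 f1 * B1 g1 + B1 f2 * B1 g2))%E).
  rewrite EFinM -muleA; apply: lee_wpmul2l; first by rewrite lee_fin ltW.
  by rewrite ge0_muleDr//; exact: leeD.
by apply: lee_wpmul2r; [rewrite adde_ge0|rewrite lee_fin le_max lexx orbT].
Qed.

End Control.
End Abstract.

(** * Continuity on the simplex *)

Section Congr.
Context {R : realType}.

Lemma eq_besov_norm (T a : R) (p q : \bar R) (chi1 chi2 : R -> R -> \bar R) :
  (forall s t, 0 <= s -> s <= t -> t <= T -> chi1 s t = chi2 s t) ->
  besov_norm T a p q chi1 = besov_norm T a p q chi2.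
Proof.
move=> H.
have HM t : 0 < t -> t <= T -> besov_modulus T p chi1 t = besov_modulus T p chi2 t.
  move=> t0 tT; congr ereal_sup; apply: eq_imagel => h /=.
  rewrite in_itv/= => /andP[h0 ht]; congr Lnorm; apply/funext => s; rewrite /patch.
  case: ifPn => // /set_mem/=; rewrite in_itv/= => /andP[s0 sT].
  by apply: H => //; lra.
rewrite !besov_normE /besov_weight; case: q => [q| |]; last by [].
  apply: (congr1 (fun x : \bar R => (x `^ _)%E)); apply: eq_integral => t.
  by rewrite inE/= in_itv/= => /andP[t0 tT]; rewrite HM.
congr Lnorm; apply/funext => t; rewrite /patch.
case: ifPn => // /set_mem/=; rewrite in_itv/= => /andP[t0 tT].
by rewrite HM.
Qed.

Lemma cvg_dist_le (S : Type) (F : set_system S) {FF : Filter F} (V : normedModType R)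
    (f : S -> V) (l : V) (D : S -> R) :
  (\forall x \near F, `|l - f x| <= D x) -> D @ F --> (0 : R) -> f @ F --> l.
Proof.
move=> fD D0; apply/cvgrPdist_lt => e e0; near=> x.
apply: (@le_lt_trans _ _ (D x)); first by near: x.
by near: x; exact: (cvgr_lt _ D0).
Unshelve. all: by end_near. Qed.

Lemma within_fst T (s t : R) :
  fst @ within (simplex T) (nbhs (s, t)) --> within `[0, T] (nbhs s).
Proof.
move=> A HA; change (nbhs (s, t) (fun st => simplex T st -> A st.1)).
have /nbhs_ballP[e /= e0 He] : nbhs s (fun u => `[0, T]%classic u -> A u) by exact: HA.
apply/nbhs_ballP; exists e => // -[u v] [/= su tv] [/= u0 [/= uv vT]].
apply: He => //; by rewrite /= in_itv/= u0 (le_trans uv).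
Qed.

Lemma within_snd T (s t : R) :
  snd @ within (simplex T) (nbhs (s, t)) --> within `[0, T] (nbhs t).
Proof.
move=> A HA; change (nbhs (s, t) (fun st => simplex T st -> A st.2)).
have /nbhs_ballP[e /= e0 He] : nbhs t (fun u => `[0, T]%classic u -> A u) by exact: HA.
apply/nbhs_ballP; exists e => // -[u v] [/= su tv] [/= u0 [/= uv vT]].
apply: He => //; by rewrite /= in_itv/= vT (le_trans u0).
Qed.

End Congr.

(** * Paths of bounded operators *)

Section Operators.
Context {R : realType} {E F : normedModType R}.
Implicit Types (f g : E -> F).

Definition opn f : R := fine (opnorm f).

Lemma opnorm_ge0 f : (0 <= opnorm f)%E.
Proof.
apply: le_trans (ereal_sup_ubound _); last by exists 0 => //=; rewrite normr0.
by rewrite lee_fin.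
Qed.

Lemma bounded_linearB f g : bounded_linear f -> bounded_linear g ->
  bounded_linear (f - g).
Proof.
move=> [lf [M HM]] [lg [N HN]]; split.
  move=> a u v; rewrite !fctE/= lf lg scalerBr opprD addrACA.
  by [].
exists (M + N) => x; rewrite !fctE/=.
by apply: (le_trans (ler_normB _ _)); rewrite mulrDl lerD.
Qed.

Lemma opnorm_fin f : bounded_linear f -> opnorm f = (opn f)%:E.
Proof.
move=> [lf [M HM]]; rewrite fineK// ge0_fin_numE ?opnorm_ge0//.
apply: (@le_lt_trans _ _ (`|M|)%:E); last exact: ltry.
apply: ge_ereal_sup => _ [x /= x1 <-]; rewrite lee_fin.
apply: (le_trans (HM x)); apply: (@le_trans _ _ (`|M| * `|x|)).
  by rewrite ler_wpM2r// ler_norm.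
by rewrite ler_piMr.
Qed.

Lemma opn_ge0 f : 0 <= opn f.
Proof. exact/fine_ge0/opnorm_ge0. Qed.

Lemma bounded_linear0 f : bounded_linear f -> f 0 = 0.
Proof.
move=> [lf _]; have := lf (-1) 0 0; rewrite scaler0 addr0 scaleN1r addNr => H.
exact: H.
Qed.

Lemma bounded_linearD f x y : bounded_linear f -> f (x + y) = f x + f y.
Proof. by move=> [lf _]; have := lf 1 x y; rewrite !scale1r. Qed.

Lemma bounded_linearZ f (a : R) x : bounded_linear f -> f (a *: x) = a *: f x.
Proof. by move=> bf; have [lf _] := bf; have := lf a x 0; rewrite bounded_linear0// !addr0. Qed.

Lemma bounded_linear_sub f x y : bounded_linear f -> f (x - y) = f x - f y.
Proof. by move=> bf; rewrite bounded_linearD// -scaleN1r bounded_linearZ// scaleN1r. Qed.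

Lemma opn_bound f x : bounded_linear f -> `|f x| <= opn f * `|x|.
Proof.
move=> bf; have [->|x0] := eqVneq x 0; first by rewrite bounded_linear0// !normr0 mulr0.
have nx0 : 0 < `|x| by rewrite normr_gt0.
rewrite -ler_pdivrMr// -lee_fin -opnorm_fin//.
apply: ereal_sup_ubound; exists (`|x|^-1 *: x).
  by rewrite /= normrZ normfV normr_id mulVf// gt_eqF.
by rewrite bounded_linearZ// normrZ normfV normr_id mulrC.
Qed.

Lemma opn_le f (M : R) : bounded_linear f -> 0 <= M ->
  (forall x, `|f x| <= M * `|x|) -> opn f <= M.
Proof.
move=> bf M0 H; rewrite -lee_fin -opnorm_fin//.
apply: ge_ereal_sup => _ [x /= x1 <-]; rewrite lee_fin.
by apply: (le_trans (H x)); rewrite ler_piMr.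
Qed.

Lemma opn_triangle f g k : bounded_linear f -> bounded_linear g -> bounded_linear k ->
  opn (f - k) <= opn (f - g) + opn (g - k).
Proof.
move=> bf bg bk; apply: opn_le; [exact: bounded_linearB|by rewrite addr_ge0 ?opn_ge0|].
move=> x; have -> : (f - k) x = (f - g) x + (g - k) x.
  by rewrite !fctE/= addrA subrK.
apply: (le_trans (ler_normD _ _)); rewrite mulrDl.
by apply: lerD; apply: opn_bound; exact: bounded_linearB.
Qed.

Lemma opnN f g : bounded_linear f -> bounded_linear g -> opn (f - g) = opn (g - f).
Proof.
move=> bf bg; apply/eqP; rewrite eq_le; apply/andP; split; apply: opn_le;
  rewrite ?opn_ge0//; try exact: bounded_linearB.
- move=> x; have -> : (f - g) x = - (g - f) x by rewrite !fctE/= opprB.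
  by rewrite normrN; apply: opn_bound; exact: bounded_linearB.
- move=> x; have -> : (g - f) x = - (f - g) x by rewrite !fctE/= opprB.
  by rewrite normrN; apply: opn_bound; exact: bounded_linearB.
Qed.

Section Path.
Variables (T : R) (Z : R -> E -> F).
Hypothesis bZ : forall t, 0 <= t <= T -> bounded_linear (Z t).
Hypothesis cZ : forall s, 0 <= s <= T ->
  opn (Z u - Z s) @[u --> within `[0, T] (nbhs s)] --> (0 : R).

(** Continuity in the two end points follows from continuity of the path, since the
    norm of an increment changes by at most the increments at the two end points. *)
Lemma pathlike_opn : pathlike T (fun s t => opn (incr Z s t)).
Proof.
split.
- by move=> s t *; exact: opn_ge0.
- apply/subspace_continuousP => -[s t] st; have [/= s0 [/= st' tT]] := st.
  have sT : 0 <= s <= T by rewrite s0 (le_trans st').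
  have tT' : 0 <= t <= T by rewrite tT (le_trans s0).
  apply: (@cvg_dist_le _ _ _ _ _ _ _
    (fun uv => opn (Z uv.1 - Z s) + opn (Z uv.2 - Z t))).
    rewrite near_withinE; apply: nearW => -[u v] [/= u0 [/= uv vT]].
    have uT : 0 <= u <= T by rewrite u0 (le_trans uv).
    have vT' : 0 <= v <= T by rewrite vT (le_trans u0).
    have bs := bZ sT; have bt := bZ tT'; have bu := bZ uT; have bv := bZ vT'.
    change (`|opn (Z t - Z s) - opn (Z v - Z u)| <= opn (Z u - Z s) + opn (Z v - Z t)).
    rewrite ler_norml.
    have h1 := opn_triangle bt bv bs; have h2 := opn_triangle bv bu bs.
    have h3 := opn_triangle bv bt bu; have h4 := opn_triangle bt bs bu.
    have e1 := opnN bt bv; have e2 := opnN bs bu.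
    by apply/andP; split; lra.
  rewrite -(addr0 0); apply: cvgD.
  - apply: (@cvg_comp _ _ _ fst (fun u => opn (Z u - Z s)) _ (within `[0, T] (nbhs s))).
      exact: within_fst.
    exact: cZ.
  - apply: (@cvg_comp _ _ _ snd (fun u => opn (Z u - Z t)) _ (within `[0, T] (nbhs t))).
      exact: within_snd.
    exact: cZ.
- move=> s sT; apply/eqP; rewrite eq_le opn_ge0 andbT; apply: opn_le => //.
    by apply: bounded_linearB; exact: bZ.
  by move=> x; rewrite /incr !fctE/= subrr normr0 mul0r.
- move=> s u t s0 su ut tT; rewrite /incr [leRHS]addrC; apply: opn_triangle; apply: bZ; lra.
Qed.

End Path.
End Operators.

Lemma opn_cvg {R : realType} {E F : normedModType R} (T : R) (Y : R -> F) (Z : R -> E -> F) :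
  continuous_controlled_path T Y Z -> forall s, 0 <= s <= T ->
  opn (Z u - Z s) @[u --> within `[0, T] (nbhs s)] --> (0 : R).
Proof. by move=> [_ H] s sT; exact: fine_cvg (H s sT). Qed.

Lemma opn_cvgB {R : realType} {E F : normedModType R} (T : R) (Z1 Z2 : R -> E -> F) :
  (forall t, 0 <= t <= T -> bounded_linear (Z1 t)) ->
  (forall t, 0 <= t <= T -> bounded_linear (Z2 t)) ->
  (forall s, 0 <= s <= T ->
     opn (Z1 u - Z1 s) @[u --> within `[0, T] (nbhs s)] --> (0 : R)) ->
  (forall s, 0 <= s <= T ->
     opn (Z2 u - Z2 s) @[u --> within `[0, T] (nbhs s)] --> (0 : R)) ->
  forall s, 0 <= s <= T ->
     opn ((Z1 u - Z2 u) - (Z1 s - Z2 s)) @[u --> within `[0, T] (nbhs s)] --> (0 : R).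
Proof.
move=> b1 b2 c1 c2 s sT.
apply: (@cvg_dist_le _ _ _ _ _ _ _ (fun u => opn (Z1 u - Z1 s) + opn (Z2 u - Z2 s))); last first.
  have := cvgD (c1 s sT) (c2 s sT); rewrite addr0 => H; exact: H.
rewrite near_withinE; apply: nearW => u; rewrite /= in_itv/= => uT.
have d1 : bounded_linear (Z1 u - Z1 s) by apply: bounded_linearB; exact: b1.
have d2 : bounded_linear (Z2 u - Z2 s) by apply: bounded_linearB; exact: b2.
rewrite sub0r normrN ger0_norm ?opn_ge0//; apply: opn_le.
- by apply: bounded_linearB; apply: bounded_linearB; (exact: b1 || exact: b2).
- by rewrite addr_ge0 ?opn_ge0.
move=> x.
have -> : (Z1 u - Z2 u - (Z1 s - Z2 s)) x = (Z1 u - Z1 s) x - (Z2 u - Z2 s) x.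
  by rewrite !fctE/= !opprB addrACA [RHS]addrACA; congr (_ + _); exact: addrC.
apply: (le_trans (ler_normB _ _)); rewrite mulrDl.
by apply: lerD; exact: opn_bound.
Qed.

(** * Rough paths and controlled paths *)

Section Remainder.
Context {R : realType} {E F : normedModType R}.

(** The delicate term Y'_s X_{s,t} is a product of two continuous factors, as
    Z_s x - Z_u y = Z_s (x - y) - (Z_u - Z_s) y. *)
Lemma remainder_continuous (T : R) (X : R -> R -> E) (Y : R -> F) (Z : R -> E -> F) :
  {within simplex T, continuous (fun st => X st.1 st.2)} ->
  (forall t, 0 <= t <= T -> bounded_linear (Z t)) ->
  continuous_controlled_path T Y Z ->
  {within simplex T, continuous (fun st => remainder X Y Z st.1 st.2)}.
Proof.
move=> /subspace_continuousP cX bZ cYZ; have cZ := opn_cvg cYZ.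
have [/subspace_continuousP cY _] := cYZ.
apply/subspace_continuousP => -[s t] st; have [/= s0 [/= st' tT]] := st.
have sT : 0 <= s <= T by rewrite s0 (le_trans st').
have tT' : 0 <= t <= T by rewrite tT (le_trans s0).
have cXst : X uv.1 uv.2 @[uv --> within (simplex T) (nbhs (s, t))] --> X s t.
  exact: (cX (s, t) st).
rewrite /remainder /incr; apply: cvgB.
  apply: cvgB.
    apply: (@cvg_comp _ _ _ snd Y _ (within `[0, T] (nbhs t))).
      exact: within_snd.
    by apply: cY; rewrite /= in_itv.
  apply: (@cvg_comp _ _ _ fst Y _ (within `[0, T] (nbhs s))).
    exact: within_fst.
  by apply: cY; rewrite /= in_itv.
apply: (@cvg_dist_le _ _ _ _ _ _ _ (fun uv => opn (Z uv.1 - Z s) * `|X uv.1 uv.2|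
    + opn (Z s) * `|X s t - X uv.1 uv.2|)).
  rewrite near_withinE; apply: nearW => -[u v] [/= u0 [/= uv vT]].
  have uT : 0 <= u <= T by rewrite u0 (le_trans uv).
  have bs := bZ _ sT; have bu := bZ _ uT.
  change (`|Z s (X s t) - Z u (X u v)| <=
    opn (Z u - Z s) * `|X u v| + opn (Z s) * `|X s t - X u v|).
  have -> : Z s (X s t) - Z u (X u v) = Z s (X s t - X u v) - (Z u - Z s) (X u v).
    by rewrite bounded_linear_sub// !fctE/= opprB addrA subrK.
  rewrite [leRHS]addrC; apply: (le_trans (ler_normB _ _)).
  by apply: lerD; apply: opn_bound => //; exact: bounded_linearB.
rewrite -(addr0 0); apply: cvgD.
  rewrite -(mul0r `|X s t|); apply: cvgM; last exact: cvg_norm.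
  apply: (@cvg_comp _ _ _ fst (fun u => opn (Z u - Z s)) _ (within `[0, T] (nbhs s))).
    exact: within_fst.
  exact: cZ.
rewrite -(mulr0 (opn (Z s))); apply: cvgMr; rewrite -(@normr0 _ E) -(subrr (X s t)).
by apply: cvg_norm; apply: cvgB => //; exact: cvg_cst.
Qed.

Lemma norm_continuous2 (V : normedModType R) (T : R) (A : R -> R -> V) :
  {within simplex T, continuous (fun st => A st.1 st.2)} ->
  continuous2 T (fun s t => `|A s t|).
Proof. by move=> cA x; apply: cvg_norm; exact: cA. Qed.

Lemma continuousB2 (V : normedModType R) (T : R) (A B : R -> R -> V) :
  {within simplex T, continuous (fun st => A st.1 st.2)} ->
  {within simplex T, continuous (fun st => B st.1 st.2)} ->
  {within simplex T, continuous (fun st => A st.1 st.2 - B st.1 st.2)}.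
Proof. by move=> cA cB x; apply: cvgB; [exact: cA|exact: cB]. Qed.

Lemma pathlike_norm (T : R) (X : R -> R -> E) :
  {within simplex T, continuous (fun st => X st.1 st.2)} ->
  (forall s u t, 0 <= s -> s <= u -> u <= t -> t <= T -> X s t = X s u + X u t) ->
  pathlike T (fun s t => `|X s t|).
Proof.
move=> cX XD; split.
- by [].
- exact: norm_continuous2.
- move=> s /andP[s0 sT]; have /eqP := XD s s s s0 (lexx _) (lexx _) sT.
  by rewrite addrC -subr_eq subrr eq_sym => /eqP ->; rewrite normr0.
- by move=> s u t s0 su ut tT; rewrite (XD s u t)// ler_normD.
Qed.

Lemma additive_diag (T : R) (X : R -> R -> E) s :
  (forall s u t, 0 <= s -> s <= u -> u <= t -> t <= T -> X s t = X s u + X u t) ->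
  0 <= s <= T -> X s s = 0.
Proof.
move=> XD /andP[s0 sT]; have /eqP := XD s s s s0 (lexx _) (lexx _) sT.
by rewrite addrC -subr_eq subrr eq_sym => /eqP.
Qed.

End Remainder.

Lemma tensor_sub_le {R : realType} {E EE : normedModType R}
    (tens : {bilinear E -> E -> EE}) (Htens : forall x y, `|tens x y| = `|x| * `|y|)
    (x x' y y' : E) :
  `|tens x y - tens x' y'| <= `|x - x'| * `|y| + `|x'| * `|y - y'|.
Proof.
have -> : tens x y - tens x' y' = tens (x - x') y + tens x' (y - y').
  by rewrite linearBl linearBr addrA subrK.
by apply: (le_trans (ler_normD _ _)); rewrite !Htens.
Qed.

Lemma subr_split (V : zmodType) (a b c d g : V) :
  a - b - g = (a - c - (b - d)) + (c - d - g).
Proof.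
have -> : a - c - (b - d) = (a - b) - (c - d).
  by rewrite !opprB addrACA [RHS]addrACA; congr (_ + _); exact: addrC.
by rewrite addrA subrK.
Qed.

(** Chen's relation at s = u = t reads XX = XX + XX since X vanishes on the diagonal. *)
Lemma second_level_diag {R : realType} {E EE : normedModType R}
    (tens : {bilinear E -> E -> EE}) (Htens : forall x y, `|tens x y| = `|x| * `|y|)
    (T : R) (X : R -> R -> E) (XX : R -> R -> EE) s :
  (forall s u t, 0 <= s -> s <= u -> u <= t -> t <= T -> X s t = X s u + X u t) ->
  (forall s u t, 0 <= s -> s <= u -> u <= t -> t <= T ->
     XX s t = XX s u + XX u t + tens (X s u) (X u t)) ->
  0 <= s <= T -> XX s s = 0.
Proof.
move=> XD XXD sT; have /andP[s0 sT'] := sT.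
have /eqP := XXD s s s s0 (lexx _) (lexx _) sT'.
have -> : tens (X s s) (X s s) = 0.
  by apply: normr0_eq0; rewrite Htens (additive_diag XD sT) normr0 mul0r.
by rewrite addr0 addrC -subr_eq subrr eq_sym => /eqP.
Qed.

Lemma remainder_split {R : realType} {E F : normedModType R} (T : R)
    (X : R -> R -> E) (Y : R -> F) (Z : R -> E -> F) s u t :
  (forall t, 0 <= t <= T -> bounded_linear (Z t)) ->
  (forall s u t, 0 <= s -> s <= u -> u <= t -> t <= T -> X s t = X s u + X u t) ->
  0 <= s -> s <= u -> u <= t -> t <= T ->
  remainder X Y Z s t =
  remainder X Y Z s u + remainder X Y Z u t + (incr Z s u) (X u t).
Proof.
move=> bZ XD s0 su ut tT; have bs : bounded_linear (Z s) by apply: bZ; lra.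
rewrite /remainder /incr (XD s u t)// bounded_linearD// !fctE/=.
rewrite -[RHS]addrA [X in _ = _ + X]addrA subrK [RHS]addrACA -opprD.
by rewrite [X in _ = X + _]addrC addrA subrK.
Qed.

Theorem theorem1p2 (R : realType) (E EE F : normedModType R)
    (tens : {bilinear E -> E -> EE}) (Htens : normed_tensor_square tens)
    (T r alpha : R) (p q : \bar R)
    (HT : 0 < T) (Hr : 2 <= r < 3)
    (Halpha : 0 < 1 / alpha < r) (Hp : (r%:E <= p)%E) (Hq : (0 < q)%E) :
  exists2 C : R, 0 < C &
  forall (X tX : R -> R -> E) (XX tXX : R -> R -> EE)
    (Y tY : R -> F) (Y' tY' : R -> E -> F),
    rough_path T r tens X XX -> continuous_rough_path T X XX ->
    rough_path T r tens tX tXX -> continuous_rough_path T tX tXX ->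
    controlled_rough_path T r X Y Y' -> continuous_controlled_path T Y Y' ->
    controlled_rough_path T r tX tY tY' -> continuous_controlled_path T tY tY' ->
    let B1 chi := besov_norm T alpha p q chi in
    let B2 chi := besov_norm T (2 * alpha) (p / 2%:E)%E (q / 2%:E)%E chi in
    let V chi := rho_variation (r / 2) chi in
    let RY := remainder X Y Y' in
    let tRY := remainder tX tY tY' in
    let DX s t := X s t - tX s t in
    let DXX s t := XX s t - tXX s t in
    let DY' t := Y' t - tY' t in
    let DRY s t := RY s t - tRY s t in
    [/\ (B2 (V (norm2 XX)) <=
           C%:E * (B2 (norm2 XX) + B1 (norm2 X) ^+ 2))%E,
        (B2 (V (norm2 RY)) <=
           C%:E * (B2 (norm2 RY)
                   + B1 (opnorm2 (incr Y')) * B1 (norm2 X)))%E,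
        (B2 (V (norm2 DXX)) <=
           C%:E * (B2 (norm2 DXX)
                   + B1 (norm2 DX) * (B1 (norm2 X) + B1 (norm2 tX))))%E &
        (B2 (V (norm2 DRY)) <=
           C%:E * (B2 (norm2 DRY)
                   + B1 (opnorm2 (incr DY')) * B1 (norm2 X)
                   + B1 (opnorm2 (incr tY')) * B1 (norm2 DX)))%E].
Proof.
case: Htens => _ Ht.
have a0 : 0 < alpha by case/andP: Halpha => + _; rewrite div1r invr_gt0.
have ar : 1 < alpha * r.
  by case/andP: Halpha => _; rewrite ltr_pdivrMr// mulrC.
have r0 : 0 < r by case/andP: Hr => r2 _; exact: lt_le_trans r2.
have p0 : (0 < p)%E by apply: lt_le_trans Hp; rewrite lte_fin.
have rho0 : 0 < r / 2 by rewrite divr_gt0.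
have arho : 1 < 2 * alpha * (r / 2).
  by have -> : 2 * alpha * (r / 2) = alpha * r by field.
have rp : ((r / 2)%:E <= p / 2%:E)%E.
  by rewrite inver pnatr_eq0/= EFinM; apply: lee_wpmul2r => //; rewrite lee_fin invr_ge0.
have [C C0 HC] := variation_product_bound HT a0 p0 Hq rho0 arho rp.
exists (C * 2); first by rewrite mulr_gt0.
move=> X tX XX tXX Y tY Y' tY' [_ _ XD XXD] [cX cXX] [_ _ tXD tXXD] [ctX ctXX]
  [bY' _ _] cY [btY' _ _] ctY B1 B2 V RY tRY DX DXX DY' DRY.
have DXD s u t : 0 <= s -> s <= u -> u <= t -> t <= T -> DX s t = DX s u + DX u t.
  by move=> s0 su ut tT; rewrite /DX (XD s u t)// (tXD s u t)// opprD addrACA.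
have cDX : {within simplex T, continuous (fun st => DX st.1 st.2)} by exact: continuousB2.
have pX := pathlike_norm cX XD; have ptX := pathlike_norm ctX tXD.
have pDX := pathlike_norm cDX DXD.
have bDY' t : 0 <= t <= T -> bounded_linear (DY' t).
  by move=> tT; apply: bounded_linearB; [exact: bY'|exact: btY'].
have pY' := pathlike_opn bY' (opn_cvg cY).
have ptY' := pathlike_opn btY' (opn_cvg ctY).
have pDY' : pathlike T (fun s t => opn (incr DY' s t)).
  by apply: pathlike_opn bDY' (opn_cvgB bY' btY' (opn_cvg cY) (opn_cvg ctY)).
have opE (Z : R -> E -> F) : (forall t, 0 <= t <= T -> bounded_linear (Z t)) ->
    B1 (opnorm2 (incr Z)) = B1 (EFin2 (fun s t => opn (incr Z s t))).
  move=> bZ; apply: eq_besov_norm => s t s0 st tT.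
  by rewrite /opnorm2 opnorm_fin//; apply: bounded_linearB; apply: bZ; lra.
have B1_ge0 chi : (0 <= B1 chi)%E by rewrite /B1 besov_normE besov_weight_ge0.
have B2_ge0 chi : (0 <= B2 chi)%E by rewrite /B2 besov_normE besov_weight_ge0.
have finish (x u v : \bar R) : (0 <= x)%E -> (0 <= u)%E -> (0 <= v)%E ->
    (C%:E * (x + u + v) <= (C * 2)%:E * (x + u + v))%E.
  move=> x0 u0 v0; apply: lee_wpmul2r; first by rewrite !adde_ge0.
  by rewrite lee_fin ler_peMr// ?ltW// ltr1n.
have double (x u : \bar R) : (0 <= x)%E -> (0 <= u)%E ->
    (C%:E * (x + u + u) <= (C * 2)%:E * (x + u))%E.
  move=> x0 u0; rewrite EFinM -muleA; apply: lee_wpmul2l; first by rewrite lee_fin ltW.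
  rewrite -[2%:E]/(1%:E + 1%:E)%E ge0_muleDl// !mul1e; apply: leeD => //.
  by rewrite leeDr.
have XXs s (sT : 0 <= s <= T) : XX s s = 0.
  exact: (second_level_diag Ht XD XXD sT).
have tXXs s (sT : 0 <= s <= T) : tXX s s = 0.
  exact: (second_level_diag Ht tXD tXXD sT).
have Xs s (sT : 0 <= s <= T) : X s s = 0 := additive_diag XD sT.
have tXs s (sT : 0 <= s <= T) : tX s s = 0 := additive_diag tXD sT.
have RYs s (sT : 0 <= s <= T) : RY s s = 0.
  by rewrite /RY /remainder /incr Xs// bounded_linear0 ?subrr//; exact: bY'.
have tRYs s (sT : 0 <= s <= T) : tRY s s = 0.
  by rewrite /tRY /remainder /incr tXs// bounded_linear0 ?subrr//; exact: btY'.
have cRY := remainder_continuous cX bY' cY.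
have ctRY := remainder_continuous ctX btY' ctY.
split.
- apply: (le_trans (HC (fun s t => `|XX s t|) _ _ _ _ _ _ _ pX pX pX pX _)).
  + by [].
  + exact: norm_continuous2.
  + by move=> s sT; rewrite XXs ?normr0.
  + move=> s u t s0 su ut tT; rewrite (XXD s u t)//.
    apply: (le_trans (ler_normD _ _)); rewrite Ht; apply: lerD.
      exact: ler_normD.
    by rewrite lerDl mulr_ge0.
  + by rewrite expe2; apply: double; rewrite ?mule_ge0.
- apply: (le_trans (HC (fun s t => `|RY s t|) _ _ _ _ _ _ _ pY' pX pY' pX _)).
  + by [].
  + exact: norm_continuous2.
  + by move=> s sT; rewrite RYs ?normr0.
  + move=> s u t s0 su ut tT; rewrite /RY (remainder_split Y bY' XD s0 su ut tT).
    apply: (le_trans (ler_normD _ _)); apply: lerD; first exact: ler_normD.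
    have bsu : bounded_linear (incr Y' s u) by apply: bounded_linearB; apply: bY'; lra.
    by apply: (le_trans (opn_bound _ bsu)); rewrite lerDl mulr_ge0 ?opn_ge0.
  + by rewrite opE//; apply: double; rewrite ?mule_ge0.
- apply: (le_trans (HC (fun s t => `|DXX s t|) _ _ _ _ _ _ _ pDX pX ptX pDX _)).
  + by [].
  + by apply: norm_continuous2; exact: continuousB2.
  + by move=> s sT; rewrite /DXX XXs ?tXXs ?subrr ?normr0.
  + move=> s u t s0 su ut tT.
    have -> : DXX s t = DXX s u + DXX u t +
        (tens (X s u) (X u t) - tens (tX s u) (tX u t)).
      by rewrite /DXX (XXD s u t)// (tXXD s u t)// !opprD addrACA [X in _ = X + _]addrACA.
    apply: (le_trans (ler_normD _ _)); apply: lerD; first exact: ler_normD.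
    exact: tensor_sub_le.
  + have -> : (B1 (norm2 DX) * (B1 (norm2 X) + B1 (norm2 tX)) =
        B1 (norm2 DX) * B1 (norm2 X) + B1 (norm2 tX) * B1 (norm2 DX))%E.
      by rewrite ge0_muleDr// [X in (_ + X)%E]muleC.
    by rewrite addeA; apply: finish; rewrite ?mule_ge0.
- apply: (le_trans (HC (fun s t => `|DRY s t|) _ _ _ _ _ _ _ pDY' pX ptY' pDX _)).
  + by [].
  + by apply: norm_continuous2; exact: continuousB2.
  + by move=> s sT; rewrite /DRY RYs ?tRYs ?subrr ?normr0.
  + move=> s u t s0 su ut tT.
    have bsu : bounded_linear (incr DY' s u) by apply: bounded_linearB; apply: bDY'; lra.
    have tbsu : bounded_linear (incr tY' s u) by apply: bounded_linearB; apply: btY'; lra.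
    have -> : DRY s t = DRY s u + DRY u t +
        (incr DY' s u (X u t) + incr tY' s u (DX u t)).
      rewrite /DRY /RY /tRY (remainder_split Y bY' XD s0 su ut tT).
      rewrite (remainder_split tY btY' tXD s0 su ut tT) !opprD addrACA.
      rewrite [X in X + _ = _]addrACA; congr (_ + _).
      by rewrite /DX (bounded_linear_sub _ _ tbsu) /incr /DY' !fctE/= -opprD; exact: subr_split.
    apply: (le_trans (ler_normD _ _)); apply: lerD; first exact: ler_normD.
    by apply: (le_trans (ler_normD _ _)); apply: lerD; exact: opn_bound.
  + by rewrite !opE//; apply: finish; rewrite ?mule_ge0.
Qed.
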